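(* Let $(\mathbf{x}_t)_{t\ge 0}$ be computed by the Stochastic Unified Momentum algorithm (described in the context) with momentum factor $\beta\in[0,1)$, parameter $s\ge 0$, deterministic initial point $\mathbf{x}_0\in\mathbb{R}^d$ and random stepsizes $(\gamma_t)_{t\ge0}$. Put $\mathcal{F}_t=\sigma(\gamma_0,\xi_0,\gamma_1,\xi_1,\dots,\gamma_{t-1},\xi_{t-1},\gamma_t)$ for $t\ge0$. Suppose that $(\gamma_t)$ is a nonnegative (random) sequence satisfying $\sum_{t=0}^\infty\gamma_t=\infty$ and $\sum_{t=0}^\infty\gamma_t^{1+\alpha}<\infty$ almost surely, and that $\xi_t$ is independent of $\mathcal{F}_t$ for every $t\ge0$. Suppose also that the oracle satisfies $\mathbf{g}(\mathbf{x}_t,\xi_t)(\omega)=\mathbf{g}(\mathbf{x}_t(\omega),\xi_t(\omega))$, i.e. a sample of $\mathbf{g}$ is unaffected by the distribution of $\mathbf{x}_t$, and likewise that a sample $\gamma_t(\omega)$ of the stepsize is unaffected by the distribution of the iterates. Then, under assumptions (A.1)-(A.5) listed in the context: (i) the sequence $f(\mathbf{x}_t)$ converges almost surely; (ii) the sequence $\nabla f(\mathbf{x}_t)$ converges to zero almost surely; (iii) if, in addition, $f$ has finitely many critical points in $\{\mathbf{x}\in\mathbb{R}^d: a\le f(\mathbf{x})\le b\}$ for any $a<b$, and $\lim_{\Vert\mathbf{x}\Vert\to\infty}f(\mathbf{x})=+\infty$, then $\mathbf{x}_t$ converges almost surely.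
   Context: $\Vert\cdot\Vert$ is the Euclidean norm on $\mathbb{R}^d$. $f:\mathbb{R}^d\to\mathbb{R}$ is the cost function. $\mathbf{g}(\mathbf{x},\xi)$ is a stochastic first order oracle: $\mathbf{g}$ is a Borel measurable $\mathbb{R}^d$-valued function, and $\xi_0,\xi_1,\dots$ are random variables on a probability space $(\Omega,\mathcal{F},\mathbb{P})$ with which the oracle is queried; write $\mathbf{g}_t=\mathbf{g}(\mathbf{x}_t,\xi_t)$. The stepsizes $\gamma_t$ are random variables on the same probability space. Stochastic Unified Momentum algorithm: given $\beta\in[0,1)$, $s\ge0$, $(\gamma_t)_{t\ge0}$ and $\mathbf{x}_0\in\mathbb{R}^d$, put $\mathbf{y}_0^s=\mathbf{x}_0$ and for $t=0,1,2,\dots$ $$\mathbf{y}_{t+1}=\mathbf{x}_t-\gamma_t\mathbf{g}_t,\qquad \mathbf{y}_{t+1}^s=\mathbf{x}_t-s\gamma_t\mathbf{g}_t,\qquad \mathbf{x}_{t+1}=\mathbf{y}_{t+1}+\beta(\mathbf{y}_{t+1}^s-\mathbf{y}_t^s).$$ Assumptions: (A.1) $f$ is continuously differentiable and $f_*:=\inf_{\mathbf{x}}f(\mathbf{x})>-\infty$. (A.2) There exist $\alpha\in(0,1]$ and $A>0$ such that $\Vert\nabla f(\mathbf{x})-\nabla f(\mathbf{y})\Vert\le A\Vert\mathbf{x}-\mathbf{y}\Vert^\alpha$ for all $\mathbf{x},\mathbf{y}\in\mathbb{R}^d$. This $\alpha$ is the one appearing in the stepsize condition. (A.3) $\mathbb{E}[\mathbf{g}(\mathbf{x},\xi)]=\nabla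 f(\mathbf{x})$ for all $\mathbf{x}\in\mathbb{R}^d$, for $\xi$ each of the $\xi_t$. (A.4) There exist positive constants $\sigma^2$ and $C$ such that $\mathbb{E}[\Vert\mathbf{g}(\mathbf{x},\xi)-\nabla f(\mathbf{x})\Vert^2]\le\sigma^2+C\Vert\nabla f(\mathbf{x})\Vert^2$ for all $\mathbf{x}\in\mathbb{R}^d$, for $\xi$ each of the $\xi_t$. (A.5) The random variables $\{\xi_t\}_{t\ge0}$ are independent of each other. *)

(* Defs.v *)
From HB Require Import structures.
From mathcomp Require Import all_boot all_order all_algebra finmap.
From mathcomp Require Import all_classical all_reals all_analysis.

Set Implicit Arguments.
Unset Strict Implicit.
Unset Printing Implicit Defensive.

Import Order.TTheory GRing.Theory Num.Theory.
Import numFieldNormedType.Exports.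

Local Open Scope classical_set_scope.
Local Open Scope ring_scope.

(* R^d is 'rV[R]_d.  The canonical norm `|x| on matrices is the sup norm; it
   induces the same topology and the same notion of differentiability as the
   Euclidean norm, but the quantitative hypotheses have to be stated with the
   latter. *)
Definition enorm (R : realType) (d : nat) (x : 'rV[R]_d) : R :=
  Num.sqrt (\sum_(i < d) x 0 i ^+ 2).

(* The filter "||x|| -> oo" on R^d. *)
Definition enorm_infty (R : realType) (d : nat) : set_system 'rV[R]_d :=
  [set A | exists r : R, forall x, r < enorm x -> A x].

Definition gradient (R : realType) (d : nat) (f : 'rV[R]_d -> R)
    (x : 'rV[R]_d) : 'rV[R]_d :=
  \row_(i < d) 'D_(delta_mx 0 i) f x.

(* For f of class C^1 the pointwise differentiability is total (Frechet); with
   it the vector of partial derivatives above is the gradient. *)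
Definition continuously_differentiable (R : realType) (d : nat)
    (f : 'rV[R]_d -> R) : Prop :=
  (forall x, differentiable f x) /\ continuous (gradient f).

(* R^d with its Borel sigma-algebra. *)
Definition borelRn (R : realType) (d : nat) :=
  g_sigma_algebraType (@open 'rV[R]_d).

Section probability.
Context {dO dX : measure_display} {Omega : measurableType dO}
  {Xi : measurableType dX} {R : realType} (P : probability Omega R).

(* E[Z] = m for a random vector Z; integrability of Z is part of the claim. *)
Definition has_mean (d : nat) (Z : Omega -> 'rV[R]_d) (m : 'rV[R]_d) : Prop :=
  forall i : 'I_d,
    P.-integrable [set: Omega] (fun w => (Z w 0 i)%:E) /\
    ('E_P[fun w => (Z w 0 i)%R])%E = (m 0 i)%:E.

Definition mutually_independent (I : choiceType)
    (X : I -> {RV P >-> Xi}) : Prop :=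
  forall (J : {fset I}) (B : I -> set Xi),
    (forall j, measurable (B j)) ->
    P (\bigcap_(j in [set` J]) (X j @^-1` B j)) =
    (\prod_(j <- J) P (X j @^-1` B j))%E.

Definition independent_of (X : {RV P >-> Xi}) (F : set_system Omega) : Prop :=
  forall (A : set Omega) (B : set Xi), F A -> measurable B ->
    P (A `&` X @^-1` B) = (P A * P (X @^-1` B))%E.

(* F_t = sigma(gamma_0, xi_0, ..., gamma_{t-1}, xi_{t-1}, gamma_t): the noise
   xi_t is not included. *)
Definition history (gamma : nat -> {RV P >-> R}) (xi : nat -> {RV P >-> Xi})
    (t : nat) : set_system Omega :=
  <<s (\bigcup_(k in [set k | (k <= t)%N])
         g_sigma_algebra_preimage (gamma k)) `|`
      (\bigcup_(k in [set k | (k < t)%N])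
         g_sigma_algebra_preimage (xi k)) >>.

End probability.

Section sum_algorithm.
Context {R : realType} {d : nat} {X : Type}.
Variables (g : 'rV[R]_d -> X -> 'rV[R]_d) (beta s : R) (x0 : 'rV[R]_d).
Variables (gamma : nat -> R) (xi : nat -> X).

(* The pair (x_t, y^s_t), for one realization of the stepsizes and of the
   noise: the oracle is evaluated at the realized iterate. *)
Fixpoint sum_state (t : nat) : 'rV[R]_d * 'rV[R]_d :=
  if t is u.+1 then
    let x := (sum_state u).1 in
    let ys := (sum_state u).2 in
    let gu := g x (xi u) in
    let y' := x - gamma u *: gu in
    let ys' := x - (s * gamma u) *: gu in
    (y' + beta *: (ys' - ys), ys')
  else (x0, x0).

Definition sum_iterate (t : nat) : 'rV[R]_d := (sum_state t).1.

End sum_algorithm.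

(* Main.v *)
Require Import Defs.
From HB Require Import structures.
From mathcomp Require Import all_boot all_order all_algebra finmap.
From mathcomp Require Import all_classical all_reals all_analysis.
From mathcomp Require Import measurable_realfun ring lra.

(* With c = beta / (1 - beta), v_t = x_t - y_t^s and z_t = x_t + c v_t, the
   algorithm becomes z_(t+1) = z_t - gamma_t / (1 - beta) g_t and
   v_(t+1) = beta v_t - (1 - s (1 - beta)) gamma_t g_t, so z is a stochastic
   gradient method up to the perturbation v.  The descent inequality for Hoelder
   gradients gives, for the Lyapunov function
   V_t = 1 + f(z_t) - inf f + 2 / (1 - beta) |v_t|^(1 + alpha),
     E[V_(t+1) | F_t] + gamma_t / (1 - beta) |grad f(z_t)|^2 + |v_t|^(1 + alpha)
       <= (1 + B gamma_t^(1 + alpha)) V_t,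
   and the Robbins-Siegmund argument yields the convergence of V_t and of the
   series of dissipated terms.  The same argument applied to the squares of M_t
   and of M_t + 1, where M_t is a coordinate of the accumulated noise
   sum_k gamma_k (g_k - grad f(x_k)), shows that M_t converges.  From here on
   the argument is pathwise: the gradient at z_t is small infinitely often, and
   it cannot grow again because the total displacement of z over a period with
   a large gradient is controlled by the tails of the two convergent series.

   Conditional expectations are avoided: a conditional inequality is tested
   against nonnegative F_t-measurable weights, and it is derived from the
   independence of xi_t and F_t by the Fubini-Tonelli theorem. *)

Set Implicit Arguments.
Unset Strict Implicit.
Unset Printing Implicit Defensive.

Import Order.TTheory GRing.Theory Num.Theory.
Import numFieldNormedType.Exports.

Local Open Scope classical_set_scope.
Local Open Scope ring_scope.

(** * The Euclidean norm *)

Section euclidean.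
Context {R : realType} {d : nat}.
Implicit Types u v w : 'rV[R]_d.

Definition dot u v : R := \sum_(i < d) u 0 i * v 0 i.

Lemma dotC u v : dot u v = dot v u.
Proof. by apply: eq_bigr => i _; rewrite mulrC. Qed.

Lemma dotDl u v w : dot (u + v) w = dot u w + dot v w.
Proof. by rewrite -big_split; apply: eq_bigr => i _; rewrite mxE mulrDl. Qed.

Lemma dotDr u v w : dot w (u + v) = dot w u + dot w v.
Proof. by rewrite dotC dotDl !(dotC w). Qed.

Lemma dotZl (a : R) u v : dot (a *: u) v = a * dot u v.
Proof. by rewrite mulr_sumr; apply: eq_bigr => i _; rewrite mxE mulrA. Qed.

Lemma dotZr (a : R) u v : dot u (a *: v) = a * dot u v.
Proof. by rewrite dotC dotZl dotC. Qed.

Lemma dotNl u v : dot (- u) v = - dot u v.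
Proof. by rewrite -scaleN1r dotZl mulN1r. Qed.

Lemma dotNr u v : dot u (- v) = - dot u v.
Proof. by rewrite dotC dotNl dotC. Qed.

Lemma dot_ge0 u : 0 <= dot u u.
Proof. by apply: sumr_ge0 => i _; rewrite -expr2 sqr_ge0. Qed.

Lemma enorm_ge0 u : 0 <= enorm u.
Proof. exact: sqrtr_ge0. Qed.

Lemma enorm_sqr u : enorm u ^+ 2 = dot u u.
Proof.
rewrite /enorm sqr_sqrtr; last by apply: sumr_ge0 => i _; exact: sqr_ge0.
by apply: eq_bigr => i _; rewrite expr2.
Qed.

Lemma enormZ (a : R) u : enorm (a *: u) = `|a| * enorm u.
Proof.
apply/eqP; rewrite -(@eqrXn2 _ 2)//; last 2 first.
- exact: enorm_ge0.
- by rewrite mulr_ge0// enorm_ge0.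
by rewrite exprMn !enorm_sqr dotZl dotZr mulrA -expr2 real_normK ?num_real.
Qed.

Lemma enormN u : enorm (- u) = enorm u.
Proof. by rewrite -scaleN1r enormZ normrN1 mul1r. Qed.

Lemma enorm0 : enorm (0 : 'rV[R]_d) = 0.
Proof. by rewrite -(scale0r 0) enormZ normr0 mul0r. Qed.

Lemma enormBC u v : enorm (u - v) = enorm (v - u).
Proof. by rewrite -opprB enormN. Qed.

(** Expanding [dot w w >= 0] for [w = dot u v *: u - dot u u *: v] gives [dot u u] times the squared
    claim; the case [dot u u = 0], in which [u] vanishes, is therefore separate. *)
Lemma cauchy_schwarz u v : `|dot u v| <= enorm u * enorm v.
Proof.
rewrite -(@ler_pXn2r _ 2)// ?nnegrE ?mulr_ge0 ?enorm_ge0//.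
rewrite exprMn !enorm_sqr real_normK ?num_real//.
have := dot_ge0 u; rewrite le_eqVlt => /orP[/eqP u0|u0].
  suff -> : dot u v = 0 by rewrite -u0 mul0r expr0n.
  move/esym/eqP: u0; rewrite psumr_eq0; last by move=> i _; rewrite -expr2 sqr_ge0.
  move=> /allP u0; apply: big1 => i _.
  by have /= := u0 i (mem_index_enum _); rewrite -expr2 sqrf_eq0 => /eqP ->; rewrite mul0r.
have := dot_ge0 (dot u v *: u - dot u u *: v).
rewrite dotDl !dotDr !dotNl !dotNr !dotZl !dotZr (dotC v u).
set a := dot u v; set b := dot u u; set c := dot v v => H.
have {}H : 0 <= b * (b * c - a ^+ 2) by move: H; rewrite expr2; lra.
by rewrite pmulr_rge0// in H; rewrite subr_ge0 in H.
Qed.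

Lemma dot_le_enorm u v : dot u v <= enorm u * enorm v.
Proof. exact: le_trans (ler_norm _) (cauchy_schwarz u v). Qed.

Lemma enormD u v : enorm (u + v) <= enorm u + enorm v.
Proof.
rewrite -(@ler_pXn2r _ 2)// ?nnegrE ?addr_ge0 ?enorm_ge0//.
rewrite enorm_sqr dotDl !dotDr sqrrD !enorm_sqr (dotC v u).
by have := dot_le_enorm u v; lra.
Qed.

Lemma enormB u v : enorm u - enorm v <= enorm (u - v).
Proof. by rewrite lerBlDr; apply: le_trans (enormD _ _); rewrite subrK. Qed.

Lemma enorm_sqrD_le u v :
  enorm (u + v) ^+ 2 <= 2 * enorm u ^+ 2 + 2 * enorm v ^+ 2.
Proof.
rewrite enorm_sqr dotDl !dotDr !enorm_sqr (dotC v u).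
have := dot_ge0 (u - v); rewrite dotDl !dotDr !dotNl !dotNr (dotC v u).
by lra.
Qed.

Lemma coord_le_norm u i : `|u 0 i| <= `|u|.
Proof.
by rewrite [leRHS]/Num.norm /= mx_normrE; apply/bigmax_geP; right; exists (0, i).
Qed.

Lemma norm_le_enorm u : `|u| <= enorm u.
Proof.
rewrite [leLHS]/Num.norm /= mx_normrE; apply/bigmax_leP; split => [|[i j] _ /=].
  exact: enorm_ge0.
rewrite ord1 -(@ler_pXn2r _ 2)// ?nnegrE ?enorm_ge0//.
rewrite real_normK ?num_real// enorm_sqr /dot (bigD1 j)//= -expr2 lerDl.
by apply: sumr_ge0 => k _; rewrite -expr2 sqr_ge0.
Qed.

Lemma enorm_le_norm u : enorm u <= d%:R * `|u|.
Proof.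
apply: (@le_trans _ _ (\sum_(i < d) `|u 0 i|)); last first.
  apply: le_trans (ler_sum _ (fun i _ => coord_le_norm u i)) _.
  by rewrite sumr_const card_ord mulr_natl.
rewrite -(@ler_pXn2r _ 2)// ?nnegrE ?enorm_ge0 ?sumr_ge0//.
rewrite enorm_sqr expr2 mulr_suml; apply: ler_sum => i _.
apply: le_trans (ler_norm _) _; rewrite normrM; apply: ler_wpM2l => //.
by rewrite (bigD1 i)//= lerDl sumr_ge0.
Qed.

Lemma enorm_lipschitz u v : `|enorm u - enorm v| <= d%:R * `|u - v|.
Proof.
rewrite ler_norml; apply/andP; split; last first.
  exact: le_trans (enormB u v) (enorm_le_norm _).
rewrite lerNl opprB distrC.
exact: le_trans (enormB v u) (enorm_le_norm _).
Qed.

Lemma enorm_continuous : continuous (@enorm R d).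
Proof.
move=> u; apply/(@cvgrPdist_le _ _ _ (nbhs u) (nbhs_filter u)) => e e0.
(* The Lipschitz constant [d] is enlarged to [d.+1] so that the division also makes sense for
   [d = 0]. *)
have e'0 : 0 < e / d.+1%:R by rewrite divr_gt0// ltr0n.
near=> v; apply: le_trans (enorm_lipschitz u v) _.
apply: (@le_trans _ _ (d.+1%:R * `|u - v|)).
  by apply: ler_wpM2r => //; rewrite ler_nat.
rewrite mulrC -ler_pdivlMr ?ltr0n//.
Unshelve. all: by end_near. Qed.

Lemma cvg_enorm0 {T : Type} {F : set_system T} {FF : Filter F} (h : T -> 'rV[R]_d) :
  enorm (h x) @[x --> F] --> 0 -> h x @[x --> F] --> (0 : 'rV[R]_d).
Proof.
move=> hF; apply/cvgr0Pnorm_le => e e0.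
move/cvgrPdist_le : hF => /(_ e e0); apply: filterS => x.
rewrite sub0r normrN ger0_norm ?enorm_ge0//.
by apply: le_trans; exact: norm_le_enorm.
Qed.

Lemma cvg0_enorm {T : Type} {F : set_system T} {FF : Filter F} (h : T -> 'rV[R]_d) :
  h x @[x --> F] --> (0 : 'rV[R]_d) -> enorm (h x) @[x --> F] --> 0.
Proof.
move=> hF; rewrite -enorm0.
exact: (continuous_cvg _ (@enorm_continuous _) hF).
Qed.

End euclidean.

(** * Functions with a Hoelder continuous gradient *)

Section real_powers.
Context {R : realType}.
Implicit Types a b u p r : R.

Lemma ler_powR_base p a b : 0 <= p -> 0 <= a -> a <= b -> a `^ p <= b `^ p.
Proof.
by move=> p0 a0 ab; apply: ge0_ler_powR => //; rewrite nnegrE ?(le_trans a0).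
Qed.

Lemma powR_1D p a : 0 < p -> 0 <= a -> a `^ (1 + p) = a * a `^ p.
Proof.
move=> p0 a0; rewrite powRD ?powRr1//; apply/implyP.
by rewrite gt_eqF// addr_gt0.
Qed.

(** A Young inequality without optimal constants: the smaller of [a] and [u] is replaced by the
    larger one. *)
Lemma mul_powR_le p a u : 0 < p -> 0 <= a -> 0 <= u ->
  a * u `^ p <= a `^ (1 + p) + u `^ (1 + p).
Proof.
move=> p0 a0 u0; have [au|ua] := leP a u.
  rewrite (powR_1D p0 u0); apply: (@le_trans _ _ (u * u `^ p)).
    by rewrite ler_wpM2r// powR_ge0.
  by rewrite lerDr powR_ge0.
rewrite (powR_1D p0 a0); apply: (@le_trans _ _ (a * a `^ p)).
  by apply: ler_wpM2l => //; apply: ler_powR_base => //; exact: ltW.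
by rewrite lerDl powR_ge0.
Qed.

(** With [p = 2] it bounds powers of norms by squares, which the variance hypothesis controls;
    [gradient_near] uses it with [p = 1 + alpha]. *)
Lemma powR_le_1D r p a : 0 <= r -> r <= p -> 0 <= a -> a `^ r <= 1 + a `^ p.
Proof.
move=> r0 rp a0; have [a1|a1] := leP a 1.
  apply: (@le_trans _ _ 1); last by rewrite lerDl powR_ge0.
  by apply: le_trans (ler_powR_base r0 a0 a1) _; rewrite powR1.
apply: le_trans (ler_powR (ltW a1) rp) _; by rewrite lerDr.
Qed.

(** Convexity of the power function. The factor [beta] survives in front of the power of [a], which
    is what makes [v] contract. *)
Lemma powR_conv_le p beta a b : 1 <= p -> 0 <= beta < 1 -> 0 <= a -> 0 <= b ->
  (beta * a + (1 - beta) * b) `^ p <= beta * a `^ p + (1 - beta) * b `^ p.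
Proof.
move=> p1 /andP[b0 b1] a0 b0'.
have bI : Itv.spec (@Itv.num_sem R) (Itv.Real `[0%Z, 1%Z]) beta.
  by rewrite /= /Itv.num_sem /= in_itv /= num_real b0 ltW.
have /(_ a b) := @convex_powR R p p1 (Itv.mk bI).
by rewrite !inE /= !in_itv /= !andbT; exact.
Qed.

End real_powers.

(** * The descent inequality and growth bounds for the gradient *)

Section smooth.
Context {R : realType} {d : nat}.
Variables (f : 'rV[R]_d -> R) (alpha A : R).
Hypotheses (fdiff : forall x, differentiable f x)
  (halpha : 0 < alpha <= 1) (hA : 0 < A)
  (fholder : forall z z' : 'rV[R]_d,
     enorm (gradient f z - gradient f z') <= A * enorm (z - z') `^ alpha).

Let alpha0 : 0 < alpha. Proof. by case/andP: halpha. Qed.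

Lemma diff_gradient (x h : 'rV[R]_d) : 'd f x h = dot (gradient f x) h.
Proof.
rewrite {1}[h]row_sum_delta linear_sum; apply: eq_bigr => i _.
by rewrite linearZ /= -deriveE// mxE /= mulrC.
Qed.

Lemma is_derive_line (x h : 'rV[R]_d) (t : R) :
  is_derive t (1 : R) (fun t : R => f (x + t *: h)) (dot (gradient f (x + t *: h)) h).
Proof.
rewrite -diff_gradient -deriveE//.
have : derivable f (x + t *: h) h by exact: diff_derivable.
have E : (fun s : R => s^-1 *: (((fun t : R => f (x + t *: h)) \o shift t) (s *: 1)
   - f (x + t *: h))) =
  (fun s : R => s^-1 *: ((f \o shift (x + t *: h)) (s *: h) - f (x + t *: h))).
  apply/funext => s /=; congr (_ *: (f _ - _)).
  have -> : s *: (1 : R) = s by exact: mulr1.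
  by rewrite scalerDl addrCA.
by move=> df; constructor; rewrite /derivable /derive E.
Qed.

Lemma gradient_mvt (x h : 'rV[R]_d) :
  exists2 t, 0 <= t <= 1 & f (x + h) - f x = dot (gradient f (x + t *: h)) h.
Proof.
have D t : t \in `](0 : R), 1[ -> is_derive t (1 : R) (fun t : R => f (x + t *: h))
    (dot (gradient f (x + t *: h)) h) by move=> _; exact: is_derive_line.
have C : {within `[(0 : R), 1], continuous (fun t : R => f (x + t *: h))}.
  apply: continuous_subspaceT => t.
  apply: differentiable_continuous; apply/derivable1_diffP.
  by have [] := is_derive_line x h t.
have [t] := MVT_segment ler01 D C; rewrite in_itv /= => t01.
rewrite subr0 mulr1 scale1r scale0r addr0 => E.
by exists t.
Qed.

(** The mean value theorem yields the gradient at some [x + t *: h], which differs from the gradient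
    at [x] by at most [A |h|^alpha]. Hence the constant [A] instead of the [A / (1 + alpha)] of the
    integral form. *)
Lemma holder_descent (x h : 'rV[R]_d) :
  f (x + h) <= f x + dot (gradient f x) h + A * enorm h `^ (1 + alpha).
Proof.
have [t /andP[t0 t1] E] := gradient_mvt x h.
have -> : f (x + h) = f x + dot (gradient f x) h
    + dot (gradient f (x + t *: h) - gradient f x) h.
  by rewrite dotDl dotNl -E; ring.
rewrite lerD2l; apply: le_trans (dot_le_enorm _ _) _.
rewrite powR_1D ?enorm_ge0// mulrCA mulrC ler_wpM2l ?enorm_ge0//.
apply: le_trans (fholder _ _) _; rewrite ler_wpM2l ?(ltW hA)//.
apply: ler_powR_base; rewrite ?enorm_ge0 ?(ltW alpha0)//.
by rewrite addrAC subrr add0r enormZ ger0_norm// ler_piMl ?enorm_ge0.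
Qed.

(* A gradient step of fixed length decreases [f] by a multiple of the squared
   gradient as soon as the gradient exceeds [1], and [f] is bounded below. *)
Lemma gradient_sqr_le (m : R) : (forall x, m <= f x) ->
  exists2 C : R, 0 < C &
    forall x, enorm (gradient f x) ^+ 2 <= C * (1 + (f x - m)).
Proof.
(* The step length [th] solves [A th^alpha = 1 / 2], so that the remainder costs at most half of the
   decrease [th G^2]. *)
move=> mf; pose th : R := (2 * A)^-1 `^ alpha^-1.
have th0 : 0 < th by apply: powR_gt0; rewrite invr_gt0 mulr_gt0.
have thE : A * th `^ alpha = 2^-1.
  rewrite /th -powRrM mulVf ?gt_eqF// powRr1 ?invr_ge0 ?mulr_ge0 ?ltW//.
  by field; rewrite gt_eqF.
exists (1 + 2 / th); first by rewrite addr_gt0// divr_gt0.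
move=> x; set G := enorm _.
have G0 : 0 <= G by exact: enorm_ge0.
have fm : 0 <= f x - m by rewrite subr_ge0.
have c0 : 0 < 2 / th by rewrite divr_gt0.
have [G1|G1] := leP G 1.
  apply: (@le_trans _ _ 1); first by rewrite expr_le1.
  rewrite -[leLHS]mulr1; apply: ler_pM => //; rewrite ?lerDl//; exact: ltW.
have H := le_trans (mf _) (holder_descent x (- th *: gradient f x)).
move: H; rewrite dotZr -enorm_sqr -/G enormZ normrN gtr0_norm// -/G.
rewrite powRM ?(ltW th0)// (powR_1D _ (ltW th0))// => H.
have GG : G `^ (1 + alpha) <= G ^+ 2.
  rewrite -powR_mulrn//; apply: ler_powR; first exact: ltW.
  by case/andP: halpha => _; lra.
have {}H : th / 2 * G ^+ 2 <= f x - m.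
  have : A * (th * th `^ alpha * G `^ (1 + alpha)) <= th / 2 * G ^+ 2.
    have -> : A * (th * th `^ alpha * G `^ (1 + alpha)) =
      (A * th `^ alpha) * th * G `^ (1 + alpha) by ring.
    rewrite thE mulrC (mulrC _ (G ^+ 2)) (mulrC 2^-1).
    by apply: ler_wpM2r => //; rewrite divr_ge0 ?ltW.
  by lra.
apply: (@le_trans _ _ (2 / th * (f x - m))).
  rewrite -ler_pdivrMl//; apply: le_trans H; rewrite le_eqVlt; apply/orP; left.
  by apply/eqP; field; rewrite gt_eqF.
by apply: ler_pM => //; [exact: ltW|rewrite lerDr|rewrite lerDr].
Qed.

(** Squaring the Hoelder bound produces the exponent [2 alpha <= 1 + alpha], hence a term that
    [lyapunov] dominates. *)
Lemma gradient_near (z z' : 'rV[R]_d) :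
  enorm (gradient f z') ^+ 2 <=
  2 * enorm (gradient f z) ^+ 2 +
  2 * A ^+ 2 * (1 + enorm (z - z') `^ (1 + alpha)).
Proof.
have -> : gradient f z' = gradient f z + (gradient f z' - gradient f z).
  by rewrite addrC subrK.
apply: le_trans (enorm_sqrD_le _ _) _; rewrite lerD2l -mulrA.
rewrite ler_wpM2l// enormBC.
apply: (@le_trans _ _ ((A * enorm (z - z') `^ alpha) ^+ 2)).
  by rewrite ler_pXn2r ?nnegrE ?enorm_ge0// mulr_ge0 ?powR_ge0 ?ltW.
rewrite exprMn ler_wpM2l ?sqr_ge0// -powR_mulrn ?powR_ge0// -powRrM.
by apply: powR_le_1D; rewrite ?enorm_ge0//; case/andP: halpha; lra.
Qed.

End smooth.

(** * One step of the algorithm: Lyapunov estimates *)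

Section one_step.
Context {R : realType} {d : nat}.
Variables (f : 'rV[R]_d -> R) (alpha A m beta kappa sigma2 C : R).
Hypotheses (fdiff : forall x, differentiable f x)
  (halpha : 0 < alpha <= 1) (hA : 0 < A)
  (fholder : forall z z' : 'rV[R]_d,
     enorm (gradient f z - gradient f z') <= A * enorm (z - z') `^ alpha)
  (mf : forall x, m <= f x) (hbeta : 0 <= beta < 1)
  (hsigma2 : 0 < sigma2) (hC : 0 < C).

Let alpha0 : 0 < alpha. Proof. by case/andP: halpha. Qed.
Let p : R := 1 + alpha.
Let p0 : 0 <= p. Proof. by rewrite /p; move: alpha0; lra. Qed.
Let p1 : 1 <= p. Proof. by rewrite /p; move: alpha0; lra. Qed.
Let q : R := 1 - beta.
Let q0 : 0 < q. Proof. by rewrite subr_gt0; case/andP: hbeta. Qed.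
Let c : R := beta / q.
Let c0 : 0 <= c. Proof. by apply: divr_ge0; [case/andP: hbeta|exact: ltW]. Qed.

(** The summand [1] keeps the function above [1], so that additive errors become multiplicative. The
    weight [2 / (1 - beta)] is chosen such that the contraction of [v] by [beta] frees exactly two
    copies of [|v|^(1 + alpha)]. *)
Definition lyapunov (z v : 'rV[R]_d) : R :=
  1 + (f z - m) + 2 / (1 - beta) * enorm v `^ (1 + alpha).

Definition dissipation (z v : 'rV[R]_d) (r : R) : R :=
  r / (1 - beta) * enorm (gradient f z) ^+ 2 + enorm v `^ (1 + alpha).

(** [D1] prices the evaluation of the gradient at [z - c *: v] instead of [z]; [D2] prices the
    Hoelder remainder and the contribution of the oracle to [v]. *)
Let D1 : R := (A * c `^ alpha / q) `^ p.
Let D2 : R := A * q^-1 `^ p + 2 * (`|kappa| / q) `^ p.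

Lemma lyapunov_ge1 z v : 1 <= lyapunov z v.
Proof.
rewrite /lyapunov -addrA lerDl addr_ge0 ?subr_ge0// mulr_ge0 ?powR_ge0//.
by rewrite divr_ge0// ltW.
Qed.

(** The deviation [y - mu] of the oracle is left in one linear and one quadratic term only, so that
    its mean and its variance suffice to integrate the bound. *)
Lemma lyapunov_step (z v y mu : 'rV[R]_d) (r : R) : 0 <= r ->
  mu = gradient f (z - c *: v) ->
  lyapunov (z - (r / q) *: y) (beta *: v - (kappa * r) *: y)
    + dissipation z v r <=
  lyapunov z v + r `^ p * (D1 * (1 + enorm (gradient f z) ^+ 2)
                          + D2 * (1 + 2 * enorm mu ^+ 2))
  + dot (- (r / q) *: gradient f z) (y - mu)
  + 2 * r `^ p * D2 * enorm (y - mu) ^+ 2.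
Proof.
move=> r0 muE.
have q0' := ltW q0.
have rq0 : 0 <= r / q by rewrite divr_ge0.
have Y : enorm y `^ p <= 1 + 2 * enorm mu ^+ 2 + 2 * enorm (y - mu) ^+ 2.
  have -> : 1 + 2 * enorm mu ^+ 2 + 2 * enorm (y - mu) ^+ 2 =
    1 + (2 * enorm (y - mu) ^+ 2 + 2 * enorm mu ^+ 2) by ring.
  apply: (@le_trans _ _ (1 + enorm y ^+ 2)).
    rewrite -powR_mulrn ?enorm_ge0//; apply: powR_le_1D; rewrite ?enorm_ge0//.
    by rewrite /p; case/andP: halpha; lra.
  rewrite lerD2l; apply: le_trans (enorm_sqrD_le _ _); by rewrite subrK.
have F : f (z - (r / q) *: y) <= f z + dot (- (r / q) *: gradient f z) (y - mu)
    - r / q * dot (gradient f z) mu + A * q^-1 `^ p * r `^ p * enorm y `^ p.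
  apply: le_trans (holder_descent fdiff halpha hA fholder _ _) _.
  rewrite -scaleNr enormZ normrN (ger0_norm rq0) !powRM ?enorm_ge0 ?mulr_ge0 ?invr_ge0//.
  by rewrite dotZr dotZl dotDr dotNr -/p le_eqVlt; apply/orP; left; apply/eqP; ring.
(* The gap between the gradients at [z] and at [z - c *: v] is at most [A (c |v|)^alpha]; its
   product with [r |grad f(z)|] is split by [mul_powR_le], at the price of one copy of [|v|^p]. *)
have G : - (r / q) * dot (gradient f z) mu <=
   - (r / q) * enorm (gradient f z) ^+ 2
   + r `^ p * D1 * (1 + enorm (gradient f z) ^+ 2) + enorm v `^ p.
  have -> : dot (gradient f z) mu =
      enorm (gradient f z) ^+ 2 - dot (gradient f z) (gradient f z - mu).
    by rewrite enorm_sqr dotDr dotNr; ring.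
  rewrite mulrBr -addrA lerD2l mulNr opprK.
  apply: (@le_trans _ _ ((r * (A * c `^ alpha / q) * enorm (gradient f z)) * enorm v `^ alpha)).
    have -> : r * (A * c `^ alpha / q) * enorm (gradient f z) * enorm v `^ alpha
      = r / q * (enorm (gradient f z) * (A * (c * enorm v) `^ alpha)).
      by rewrite powRM ?enorm_ge0//; ring.
    apply: ler_wpM2l => //; apply: le_trans (dot_le_enorm _ _) _.
    apply: ler_wpM2l; rewrite ?enorm_ge0//.
    rewrite muE; apply: le_trans (fholder _ _) _.
    by rewrite subKr enormZ ger0_norm.
  have X0 : 0 <= A * c `^ alpha / q by rewrite !mulr_ge0 ?invr_ge0 ?powR_ge0// ltW.
  apply: le_trans (mul_powR_le _ _ _) _; rewrite ?enorm_ge0//.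
    exact: mulr_ge0 (mulr_ge0 r0 X0) (enorm_ge0 _).
  rewrite lerD2r -/p (powRM _ (mulr_ge0 r0 X0) (enorm_ge0 _)) (powRM _ r0 X0).
  rewrite -/D1 ler_wpM2l//; first by rewrite /D1 mulr_ge0 ?powR_ge0.
  rewrite -powR_mulrn ?enorm_ge0//; apply: powR_le_1D; rewrite ?enorm_ge0//.
  by rewrite /p; case/andP: halpha; lra.
(* The oracle term is written as [1 - beta] times its quotient by [1 - beta], which makes the bound
   of the norm a convex combination. *)
have H : enorm (beta *: v - (kappa * r) *: y) `^ p <=
   beta * enorm v `^ p + q * (`|kappa| / q) `^ p * r `^ p * enorm y `^ p.
  apply: (@le_trans _ _ ((beta * enorm v + (1 - beta) * (`|kappa| / q * r * enorm y)) `^ p)).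
    apply: ler_powR_base; rewrite ?enorm_ge0//.
    apply: le_trans (enormD _ _) _; rewrite enormN !enormZ normrM.
    rewrite (ger0_norm r0) (@ger0_norm _ beta); last by case/andP: hbeta.
    by rewrite lerD2l le_eqVlt -/q; apply/orP; left; apply/eqP; field; rewrite gt_eqF.
  apply: le_trans (powR_conv_le _ _ _ _) _ => //; rewrite ?enorm_ge0//.
    by rewrite !mulr_ge0 ?invr_ge0 ?enorm_ge0.
  rewrite lerD2l -/q !(@powRM _ (_ * _)) ?mulr_ge0 ?invr_ge0 ?enorm_ge0//.
  by rewrite !mulrA.
(* Of the two copies of [|v|^p] freed by the contraction, one absorbs the last term of [G] and the
   other enters [dissipation]. *)
have K : 2 / q * beta + 2 = 2 / q by rewrite /q; field; rewrite gt_eqF.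
have H2 := ler_wpM2l (divr_ge0 (ler0n R 2) q0') H.
have D20 : 0 <= r `^ p * D2.
  rewrite mulr_ge0 ?powR_ge0// addr_ge0 ?mulr_ge0 ?powR_ge0//; exact: ltW.
have Y2 := ler_wpM2l D20 Y.
rewrite /lyapunov /dissipation -/p -/q.
move: (enorm v `^ p) (enorm y `^ p) (r `^ p) (enorm (gradient f z)) F G H2 Y2 => V Yp rp Gz.
have E2 : 2 / q * (beta * V + q * (`|kappa| / q) `^ p * rp * Yp) =
  2 / q * V - 2 * V + 2 * (`|kappa| / q) `^ p * rp * Yp.
  rewrite -{2}K; field; by rewrite gt_eqF.
rewrite E2 /D2.
move: (f _) (dot _ _) (dot _ _) (enorm _ `^ _) (enorm _ ^+ 2)
  (enorm mu ^+ 2) (q^-1 `^ p) ((`|kappa| / q) `^ p).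
move=> a1 a2 a3 a4 a5 a6 a7 a8; move: D1 (r / q) (2 / q) K => D1' rq qq K'.
nra.
Qed.

(** Both gradients that occur in the errors, at [z] and at the iterate [z - c *: v], are controlled
    by the Lyapunov function, so the errors become multiples of it. *)
Lemma gradient_sqr_lyapunov : exists2 M : R, 0 <= M & forall z v,
  enorm (gradient f z) ^+ 2 <= M * lyapunov z v /\
  enorm (gradient f (z - c *: v)) ^+ 2 <= M * lyapunov z v.
Proof.
have [E E0 gE] := gradient_sqr_le fdiff halpha hA fholder mf.
pose a := c `^ p.
have a0 : 0 <= a by exact: powR_ge0.
pose M := 2 * E + 2 * A ^+ 2 * (1 + a).
have M0 : 0 <= 2 * A ^+ 2 * (1 + a).
  by rewrite !mulr_ge0// ?(ltW hA)// addr_ge0.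
exists M => [|z v]; first by rewrite addr_ge0// mulr_ge0// ltW.
have V1 := lyapunov_ge1 z v.
have Gz : enorm (gradient f z) ^+ 2 <= E * lyapunov z v.
  apply: le_trans (gE z) _; rewrite ler_wpM2l ?(ltW E0)//.
  by rewrite lerDl mulr_ge0 ?powR_ge0// divr_ge0// ltW.
split.
  apply: le_trans Gz _; rewrite ler_wpM2r ?(le_trans ler01)//.
  by rewrite /M; move: E0 M0; lra.
have vV : 1 + a * enorm v `^ p <= (1 + a) * lyapunov z v.
  have : enorm v `^ p <= lyapunov z v.
    apply: (@le_trans _ _ (2 / q * enorm v `^ p)).
      rewrite ler_peMl ?powR_ge0// ler_pdivlMr//.
      by rewrite /q; case/andP: hbeta; lra.
    by rewrite lerDr -[leLHS](addr0 0) lerD// subr_ge0.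
  by move: (enorm v `^ p) => w wV; nra.
apply: le_trans (gradient_near halpha hA fholder z _) _.
have -> : M * lyapunov z v =
  2 * (E * lyapunov z v) + 2 * A ^+ 2 * ((1 + a) * lyapunov z v) by rewrite /M; ring.
rewrite lerD//; first by rewrite ler_wpM2l.
rewrite subKr enormZ (ger0_norm c0) powRM ?enorm_ge0// -/p -/a.
by rewrite ler_wpM2l// mulr_ge0// sqr_ge0.
Qed.

(** The witnesses [c0], [u], [k] do not depend on [y]: this is the shape that [integral_mean_bound]
    integrates, with [sigma2 + C |mu|^2] as variance bound. The second inequality then gives the
    conditional drift. *)
Lemma lyapunov_drift : exists2 B : R, 0 <= B &
  forall (z v mu : 'rV[R]_d) (r : R), 0 <= r -> mu = gradient f (z - c *: v) ->
  exists c0 (u : 'rV[R]_d) k, [/\ 0 <= k,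
    forall y, lyapunov (z - (r / q) *: y) (beta *: v - (kappa * r) *: y)
      + dissipation z v r <=
      c0 + dot u (y - mu) + k * enorm (y - mu) ^+ 2 &
    c0 + k * (sigma2 + C * enorm mu ^+ 2) <= (1 + B * r `^ p) * lyapunov z v].
Proof.
have [M M0 gM] := gradient_sqr_lyapunov.
have D10 : 0 <= D1 by exact: powR_ge0.
have D20 : 0 <= D2.
  by rewrite addr_ge0 ?mulr_ge0 ?powR_ge0//; exact: ltW.
exists (D1 * (1 + M) + D2 * (1 + 2 * sigma2 + (2 + 2 * C) * M)).
  have K : 0 <= (2 + 2 * C) * M by rewrite mulr_ge0//; move: (ltW hC); lra.
  by rewrite addr_ge0// mulr_ge0//; move: M0 (ltW hsigma2); lra.
move=> z v mu r r0 muE.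
exists (lyapunov z v + r `^ p * (D1 * (1 + enorm (gradient f z) ^+ 2)
                          + D2 * (1 + 2 * enorm mu ^+ 2))).
exists (- (r / q) *: gradient f z), (2 * r `^ p * D2); split.
- by rewrite !mulr_ge0// powR_ge0.
- by move=> y; exact: lyapunov_step.
have V1 := lyapunov_ge1 z v.
have [Gz] := gM z v; rewrite -muE => mV.
have rp0 : 0 <= r `^ p by exact: powR_ge0.
rewrite [leRHS]mulrDl mul1r -addrA lerD2l.
have -> : r `^ p * (D1 * (1 + enorm (gradient f z) ^+ 2) + D2 * (1 + 2 * enorm mu ^+ 2))
   + 2 * r `^ p * D2 * (sigma2 + C * enorm mu ^+ 2) =
  r `^ p * (D1 * (1 + enorm (gradient f z) ^+ 2) +
     D2 * (1 + 2 * sigma2 + (2 + 2 * C) * enorm mu ^+ 2)) by ring.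
have -> : (D1 * (1 + M) + D2 * (1 + 2 * sigma2 + (2 + 2 * C) * M)) * r `^ p * lyapunov z v =
  r `^ p * (D1 * ((1 + M) * lyapunov z v) +
    D2 * ((1 + 2 * sigma2) * lyapunov z v + (2 + 2 * C) * (M * lyapunov z v))) by ring.
rewrite ler_wpM2l// lerD// ler_wpM2l//; first by nra.
have : (2 + 2 * C) * enorm mu ^+ 2 <= (2 + 2 * C) * (M * lyapunov z v).
  by rewrite ler_wpM2l// addr_ge0// mulr_ge0// ltW.
have : 1 + 2 * sigma2 <= (1 + 2 * sigma2) * lyapunov z v.
  by rewrite ler_peMr// addr_ge0// mulr_ge0// ltW.
by move=> h1 h2; apply: lerD.
Qed.

End one_step.

(** * Integration of independent noise and Borel vectors *)

Section mean_bound.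
Context {R : realType} {d : nat} {dO : measure_display}
  {Omega : measurableType dO} (P : probability Omega R).

(** The linear term has mean zero and the quadratic one is bounded by the variance. The
    integrability of [F] follows from its domination by this integrable quadratic. *)
Lemma integral_mean_bound (F : Omega -> R) (Y : Omega -> 'rV[R]_d)
    (mu u : 'rV[R]_d) (c0 k S : R) :
  measurable_fun setT F -> (forall w, 0 <= F w) -> 0 <= k ->
  has_mean P Y mu ->
  ('E_P[fun w => (enorm (Y w - mu) ^+ 2)%R] <= S%:E)%E ->
  (forall w, F w <= c0 + dot u (Y w - mu) + k * enorm (Y w - mu) ^+ 2) ->
  (\int[P]_w (F w)%:E <= (c0 + k * S)%:E)%E.
Proof.
move=> mF F0 k0 hY hS hF.
pose e w := enorm (Y w - mu) ^+ 2.
have mYi i : measurable_fun setT (fun w => Y w 0 i).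
  by have [/measurable_int/measurable_EFinP] := hY i.
have me : measurable_fun setT e.
  rewrite (_ : e = fun w => \sum_(i < d) (Y w 0 i - mu 0 i) ^+ 2).
    apply: measurable_sum => i; apply: measurable_funX.
    by apply: measurable_funB => //; exact: measurable_cst.
  apply/funext => w; rewrite /e enorm_sqr; apply: eq_bigr => i _.
  by rewrite !mxE expr2.
move: hS; rewrite expectation.unlock => hS.
have ie : P.-integrable setT (EFin \o e).
  apply/integrableP; split; first exact/measurable_EFinP.
  apply: le_lt_trans (ltry S); apply: le_trans hS.
  apply: ge0_le_integral => //=.
  - by apply/measurable_EFinP; exact: measurableT_comp.
  - exact/measurable_EFinP.
  - by move=> w _; rewrite ger0_norm// sqr_ge0.
pose l w := dot u (Y w - mu).
have lE : EFin \o l = fun w => (\sum_(i < d) (u 0 i)%:E * ((Y w 0 i)%:E - (mu 0 i)%:E))%E.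
  apply/funext => w /=; rewrite /l /dot -sumEFin; apply: eq_bigr => i _.
  by rewrite !mxE EFinM EFinB.
have iYm i : P.-integrable setT (fun w => (Y w 0 i)%:E - (mu 0 i)%:E)%E.
  apply: integrableB => //; first by have [] := hY i.
  exact: finite_measure_integrable_cst.
have il : P.-integrable setT (EFin \o l).
  by rewrite lE; apply: integrable_sum => // i _; exact: integrableZl.
have El : (\int[P]_w (l w)%:E = 0)%E.
  rewrite -[X in integral _ _ X]/(EFin \o l) lE integral_sum//; last first.
    by move=> i; exact: integrableZl.
  apply: big1 => i _; rewrite integralZl//.
  rewrite integralB//; last 2 first.
  - by have [] := hY i.
  - exact: finite_measure_integrable_cst.
  have [_] := hY i; rewrite expectation.unlock => ->.
  by rewrite integral_cst//= probability_setT mule1 subee// mule0.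
have ic : P.-integrable setT (fun=> c0%:E) by exact: finite_measure_integrable_cst.
have ike : P.-integrable setT (fun w => k%:E * (e w)%:E)%E by exact: integrableZl.
have icl : P.-integrable setT ((fun=> c0%:E) \+ (EFin \o l))%E by exact: integrableD.
have iG : P.-integrable setT
    (((fun=> c0%:E) \+ (EFin \o l)) \+ (fun w => k%:E * (e w)%:E))%E.
  exact: integrableD.
apply: (@le_trans _ _
  (\int[P]_w ((((fun=> c0%:E) \+ (EFin \o l)) \+ (fun w => k%:E * (e w)%:E))%E w))%E).
  apply: le_integral => //=.
    apply: le_integrable iG => //; first exact/measurable_EFinP.
    move=> w _ /=; rewrite lee_fin ger0_norm// ger0_norm.
      by have := hF w.
    by apply: le_trans (F0 w) _; have := hF w.
  by move=> w _; rewrite lee_fin; have := hF w.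
rewrite integralD// integralD// El adde0 integral_cst//= probability_setT mule1.
rewrite integralZl// EFinD leeD2l// EFinM.
by rewrite lee_wpmul2l// lee_fin.
Qed.

End mean_bound.

Lemma measurable_fun_freeze {d1 d2 d3 d4} {T1 : measurableType d1}
    {T2 : measurableType d2} {T3 : measurableType d3} {T : measurableType d4}
    (h : T1 * T2 -> T3) (X : T -> T2) (y : T1) :
  measurable_fun setT h -> measurable_fun setT X ->
  measurable_fun setT (fun w => h (y, X w)).
Proof.
move=> mh mX; apply: (measurableT_comp (f := fun y' => h (y, y'))) => //.
exact: measurableT_comp mh (measurable_pair1 _).
Qed.

(** * Integration over noise independent of a sub-sigma-algebra *)

Section freezing.
Context {R : realType} {dO dX : measure_display} {Omega : measurableType dO}
  {Xi : measurableType dX} (P : probability Omega R).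

(* Measurability with respect to the sub-sigma-algebra generated by [G] is
   measurability on the type [g_sigma_algebraType G], convertible to [Omega]. *)
Variable G : set_system Omega.
Hypothesis sG : <<s G >> `<=` (@measurable _ Omega).

Lemma measurable_fun_sub : measurable_fun [set: Omega] (id : Omega -> g_sigma_algebraType G).
Proof. by move=> _ B mB; rewrite setTI; exact: sG. Qed.

Lemma measurable_fun_coarse {d'} {T : measurableType d'} (h : g_sigma_algebraType G -> T) :
  measurable_fun [set: g_sigma_algebraType G] h -> measurable_fun [set: Omega] h.
Proof. by move=> mh; exact: (measurableT_comp mh measurable_fun_sub). Qed.

Variable X : {RV P >-> Xi}.
Hypothesis XG : independent_of X <<s G >>.

(** The identity as a measurable map onto the coarser space; its [distribution] is the restriction
    of [P] to the sub-sigma-algebra. *)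
Let inc_mixin := isMeasurableFun.Build _ _ _ _ _ measurable_fun_sub.
Let inc : {mfun Omega >-> g_sigma_algebraType G} :=
  HB.pack (id : Omega -> g_sigma_algebraType G) inc_mixin.

Let joint (w : Omega) : g_sigma_algebraType G * Xi := (w, X w).

Let measurable_joint : measurable_fun [set: Omega] joint.
Proof. by apply: measurable_fun_pair => //; exact: measurable_fun_sub. Qed.

Let joint_mixin := isMeasurableFun.Build _ _ _ _ _ measurable_joint.
Let mjoint : {mfun Omega >-> (g_sigma_algebraType G * Xi)%type} :=
  HB.pack joint joint_mixin.

(** By independence the joint law of the identity and [X] agrees with a product measure on
    rectangles, hence everywhere; the Fubini-Tonelli theorem and changes of variables do the
    rest. *)
Lemma integral_freezing (h : g_sigma_algebraType G * Xi -> \bar R) :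
  measurable_fun setT h -> (forall x, 0 <= h x)%E ->
  (\int[P]_w h (w, X w) = \int[P]_w \int[P]_w' h (w, X w'))%E.
Proof.
move=> mh h0.
rewrite -[LHS](@ge0_integral_distribution _ _ _ _ _ P mjoint)//.
have E : forall B, measurable B ->
    (distribution P inc \x distribution P X)%E B = distribution P mjoint B.
  apply: product_measure_unique => A B mA mB.
  rewrite /distribution /pushforward /= -XG//.
transitivity (\int[(distribution P inc \x distribution P X)%E]_z h z)%E.
  by apply: eq_measure_integral => B mB _; symmetry; exact: E.
rewrite fubini_tonelli1// /fubini_F.
rewrite (@ge0_integral_distribution _ _ _ _ _ P inc); last 2 first.
- exact: measurable_fun_fubini_tonelli_F.
- by move=> y; apply: integral_ge0.
apply: eq_integral => w _ /=.
rewrite ge0_integral_distribution//.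
exact: measurableT_comp mh (measurable_pair1 _).
Qed.

(** The tested form of [E[h(., X) | G] <= k]: the noise is integrated for a frozen past [w], then
    the weight [phi] is applied. *)
Lemma integral_freezing_le (h : g_sigma_algebraType G * Xi -> R) (k phi : Omega -> R) :
  measurable_fun setT h -> (forall y, 0 <= h y) ->
  measurable_fun [set: g_sigma_algebraType G] (k : g_sigma_algebraType G -> R) ->
  measurable_fun [set: g_sigma_algebraType G] (phi : g_sigma_algebraType G -> R) ->
  (forall w, 0 <= phi w) ->
  (forall w, \int[P]_w' (h (w, X w'))%:E <= (k w)%:E)%E ->
  (\int[P]_w (phi w * h (w, X w))%:E <= \int[P]_w (phi w * k w)%:E)%E.
Proof.
move=> mh h0 mk mphi phi0 hk.
pose H (y : g_sigma_algebraType G * Xi) : \bar R := (phi y.1 * h y)%:E.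
have mH : measurable_fun setT H.
  apply/measurable_EFinP/measurable_funM => //.
  exact: measurableT_comp mphi measurable_fst.
have H0 y : (0 <= H y)%E by rewrite lee_fin mulr_ge0.
rewrite (integral_freezing mH H0).
have mhw (w : Omega) : measurable_fun setT (fun w' => (h (w, X w'))%:E).
  by apply/measurable_EFinP; apply: (@measurable_fun_freeze _ _ _ _ _ _ _ _ h X w mh).
have E w : (\int[P]_w' H (w, X w') = (phi w)%:E * \int[P]_w' (h (w, X w'))%:E)%E.
  rewrite -ge0_integralZl_EFin//.
  by move=> w' _; rewrite lee_fin.
apply: ge0_le_integral => //=.
- by move=> w _; apply: integral_ge0.
(* As an integral against the law of [X], the inner integral is measurable for the
   sub-sigma-algebra, hence on [Omega]. *)
- rewrite (_ : (fun w => _) = fun w => \int[distribution P X]_y H (w, y))%E.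
    apply: measurable_fun_coarse.
    have := @measurable_fun_fubini_tonelli_F _ _ _ _ _ (distribution P X) H mH H0.
    exact.
  apply/funext => w; rewrite ge0_integral_distribution//.
  exact: measurableT_comp mH (measurable_pair1 _).
- by apply/measurable_EFinP/measurable_funM; exact: measurable_fun_coarse.
- move=> w _; rewrite E EFinM; apply: lee_wpmul2l => //.
  by rewrite lee_fin.
Qed.

End freezing.

(** * Borel measurability of vector-valued maps *)

Section borel_vectors.
Context {R : realType} {d : nat}.

Lemma measurable_borel_continuous (h : 'rV[R]_d -> R) :
  continuous h -> measurable_fun [set: borelRn R d] (h : borelRn R d -> R).
Proof.
move=> /continuousP ch; apply: (measurability _ (RGenOpens.measurableE R)).
move=> _ [_ [a [b ->]] <-]; rewrite setTI; apply: sub_sigma_algebra.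
exact/ch/interval_open.
Qed.

Lemma measurable_borel_continuous_vec (h : 'rV[R]_d -> 'rV[R]_d) :
  continuous h -> measurable_fun [set: borelRn R d] (h : borelRn R d -> borelRn R d).
Proof.
move=> /continuousP ch; apply: (@measurability _ _ _ (borelRn R d) _ _ (@open 'rV[R]_d) erefl).
by move=> _ [B oB <-]; rewrite setTI; apply: sub_sigma_algebra; exact: ch.
Qed.

(** An open set is the union of the countably many boxes with rational data that it contains, so the
    coordinates decide measurability. *)
Lemma measurable_borelP {dT} {T : measurableType dT} (h : T -> borelRn R d) :
  (forall i, measurable_fun [set: T] (fun x => (h x : 'rV[R]_d) 0 i : R)) ->
  measurable_fun [set: T] h.
Proof.
move=> mh; apply: (@measurability _ _ _ (borelRn R d) _ _ (@open 'rV[R]_d) erefl).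
move=> _ [U oU <-]; rewrite setTI.
pose box (c : 'rV[rat]_d * rat) : set 'rV[R]_d :=
  [set v | forall i, `|v 0 i - ratr (c.1 0 i)| < ratr c.2].
pose F c := if `[< box c `<=` U >] then h @^-1` box c else set0.
have -> : h @^-1` U = \bigcup_c F c.
  apply/seteqP; split => [x /= Uhx|x [c _]]; last first.
    by rewrite /F; case: ifPn => // /asboolP cU /= /cU.
  have /nbhs_ballP[e /= e0 eU] : nbhs (h x : 'rV[R]_d) U by exact: open_nbhs_nbhs.
  (* With a radius below [e / 2], a box whose centre is closer than this radius to [h x] in every
     coordinate stays in the ball of radius [e]. *)
  have [r] := rat_in_itvoo (divr_gt0 e0 (ltr0n R 2)); rewrite in_itv /= => /andP[r0 re].
  have H i : exists q : rat, `|(h x : 'rV[R]_d) 0 i - ratr q| < ratr r.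
    have [|q] := @rat_in_itvoo R ((h x : 'rV[R]_d) 0 i - ratr r)
      ((h x : 'rV[R]_d) 0 i + ratr r).
      by rewrite ltrD2l gtrN.
    rewrite in_itv /= => /andP[q1 q2]; exists q.
    by rewrite ltr_norml; apply/andP; split; lra.
  have [q hq] := choice H.
  exists (\row_i q i, r) => //; rewrite /F asboolT /=.
    by move=> i /=; rewrite mxE.
  move=> v hv; apply: eU; rewrite /ball /= /mx_ball; split => // i j.
  rewrite ord1 /ball /=; have := hv j; have := hq j; rewrite /= mxE => h1 h2.
  apply: (@le_lt_trans _ _ (`|(h x : 'rV[R]_d) 0 j - ratr (q j)| + `|v 0 j - ratr (q j)|)).
    by rewrite (distrC (v 0 j)); exact: ler_distD.
  by move: h1 h2 re; lra.
apply: countable_bigcupT_measurable => [|c]; first exact: countableP.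
rewrite /F; case: ifP => // _.
rewrite -[X in measurable X]setCK; apply: measurableC.
have -> : ~` (h @^-1` box c) =
    \bigcup_i [set x | ratr c.2 <= `|(h x : 'rV[R]_d) 0 i - ratr (c.1 0 i)|].
  apply/seteqP; split => [x /= /existsNP[i /negP]|x [i _] /= H /(_ i)].
    by rewrite -leNgt => H; exists i.
  by rewrite ltNge H.
apply: countable_bigcupT_measurable => [|i]; first exact: countableP.
rewrite -[X in measurable X]setTI; apply: measurable_fun_ler => //.
apply: measurableT_comp => //; exact: measurable_funB.
Qed.

Lemma measurable_borel_coord {dT} {T : measurableType dT} (h : T -> borelRn R d) i :
  measurable_fun [set: T] h ->
  measurable_fun [set: T] (fun x => (h x : 'rV[R]_d) 0 i : R).
Proof.
move=> mh.
apply: (@measurableT_comp _ _ _ _ _ _ (fun v : borelRn R d => (v : 'rV[R]_d) 0 i)) => //.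
by apply: measurable_borel_continuous; exact: coord_continuous.
Qed.

Lemma measurable_borelD {dT} {T : measurableType dT} (h k : T -> borelRn R d) :
  measurable_fun [set: T] h -> measurable_fun [set: T] k ->
  measurable_fun [set: T] (fun x => (h x : 'rV[R]_d) + k x : borelRn R d).
Proof.
move=> mh mk; apply: measurable_borelP => i.
under eq_fun do rewrite mxE.
by apply: measurable_funD; exact: measurable_borel_coord.
Qed.

Lemma measurable_borelZ {dT} {T : measurableType dT} (a : T -> R) (h : T -> borelRn R d) :
  measurable_fun [set: T] a -> measurable_fun [set: T] h ->
  measurable_fun [set: T] (fun x => a x *: (h x : 'rV[R]_d) : borelRn R d).
Proof.
move=> ma mh; apply: measurable_borelP => i.
under eq_fun do rewrite mxE.
by apply: measurable_funM => //; exact: measurable_borel_coord.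
Qed.

Lemma measurable_borelB {dT} {T : measurableType dT} (h k : T -> borelRn R d) :
  measurable_fun [set: T] h -> measurable_fun [set: T] k ->
  measurable_fun [set: T] (fun x => (h x : 'rV[R]_d) - k x : borelRn R d).
Proof.
move=> mh mk; apply: measurable_borelP => i.
under eq_fun do rewrite 2!mxE.
by apply: measurable_funB; exact: measurable_borel_coord.
Qed.

End borel_vectors.

(** * Convergence of nonnegative supermartingales *)

Section upcrossings.
Context {R : realType}.
Implicit Types (u : nat -> R) (a b : R).

(* The state at time [t] of an automaton that turns on when [u] drops below [a]
   and off when [u] exceeds [b]; it turns off once per upcrossing of [a, b]. *)
Fixpoint below_then_above u a b (t : nat) : bool :=
  if t is k.+1 then
    if below_then_above u a b k then u t <= b else u t < a
  else u 0%N < a.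

Definition upcross u a b (t : nat) : bool :=
  below_then_above u a b t && ~~ below_then_above u a b t.+1.

(** If the automaton is on at some late time, it never turns off again and [u] stays below [b];
    otherwise it never turns on and [u] stays above [a]. *)
Lemma upcross_finite u a b :
  (\forall t \near \oo, ~~ upcross u a b t) ->
  (\forall t \near \oo, u t <= b) \/ (\forall t \near \oo, a <= u t).
Proof.
move=> [N _ hN].
have [[m Nm Hm]|H] := pselect (exists2 m, (N <= m)%N & below_then_above u a b m).
  have H t : (m <= t)%N -> below_then_above u a b t.
    elim: t => [|t IH]; first by rewrite leqn0 => /eqP <-.
    rewrite leq_eqVlt => /orP[/eqP <- //|]; rewrite ltnS => mt.
    have := hN t (leq_trans Nm mt); rewrite /= /upcross (IH mt) /= negbK.
    by rewrite (IH mt).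
  left; exists m.+1 => // -[//|t] /= mt.
  by have := H t.+1 (ltnW mt); rewrite /= (H t mt).
right; exists N.+1 => // -[//|t] /= Nt.
have Ht : below_then_above u a b t = false.
  by apply/negP => Ht; apply: H; exists t.
have : ~ below_then_above u a b t.+1.
  by move=> Ht1; apply: H; exists t.+1 => //; exact: ltnW.
by rewrite /= Ht => /negP; rewrite -leNgt.
Qed.

(** The limit is the limsup, taken as the infimum of the eventual upper bounds. For rationals
    [p < r] below it, [u] cannot be eventually below [r], so the upcrossing dichotomy puts it
    eventually above [p]. Nonpositive [a] are settled by [u >= 0]. *)
Lemma cvg_of_upcross u : (forall t, 0 <= u t) ->
  (exists M, forall N, exists2 t, (N <= t)%N & u t <= M) ->
  (forall a b : rat, a < b -> 0 < (ratr a : R) ->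
    \forall t \near \oo, ~~ upcross u (ratr a) (ratr b) t) ->
  cvg (u t @[t --> \oo]).
Proof.
move=> u0 [M hM] hu.
have key (a b : rat) : a < b ->
    (\forall t \near \oo, u t <= ratr b) \/ (\forall t \near \oo, ratr a <= u t).
  move=> ab; have [a0|a0] := ltP 0 (ratr a : R).
    exact: upcross_finite (hu _ _ ab a0).
  by right; apply: nearW => t; exact: le_trans a0 (u0 t).
pose S := [set b : R | \forall t \near \oo, u t <= b].
have [q] := @rat_in_itvoo R M (M + 1) ltac:(by rewrite ltrDl).
rewrite in_itv /= => /andP[Mq _].
have Sne : S !=set0.
  have [|[N _ H]|[N _ H]] := key q (q + 1); first by rewrite ltrDl.
    by exists (ratr (q + 1)); exists N.
  have [t Nt ut] := hM N; have := H t Nt => /= qt.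
  by have := le_lt_trans (le_trans qt ut) Mq; rewrite ltxx.
have Slb : lbound S 0.
  by move=> b [N _ H]; exact: le_trans (u0 N) (H N (leqnn N)).
have hS : has_inf S by split => //; exists 0.
apply/cvg_ex; exists (inf S); apply/cvgrPdist_le => e e0.
have [b Sb bL] := inf_adherent e0 hS.
have [p] := @rat_in_itvoo R (inf S - e) (inf S) ltac:(by rewrite ltrBlDr ltrDl).
rewrite in_itv /= => /andP[p1 p2].
have [r] := rat_in_itvoo p2.
rewrite in_itv /= => /andP[pr rL].
have [|H|H] := key p r.
- by rewrite -(@ltr_rat R).
- have : S (ratr r) by [].
  by move=> /(ge_inf (ex_intro _ 0 Slb)); rewrite leNgt rL.
near=> t.
have h1 : u t <= b by near: t.
have h2 : ratr p <= u t by near: t.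
rewrite ler_norml; apply/andP; split; lra.
Unshelve. all: by end_near. Qed.

(* Gambling one unit while the automaton is on earns at least [b - a] per
   upcrossing; the loss on an unfinished one is at most [a]. *)
Definition upcross_gain u a b (t : nat) : R :=
  (b - a) * \sum_(k < t) (upcross u a b k)%:R +
  (if below_then_above u a b t then u t - a else 0) + a.

(** While the automaton is on, the gain grows at most like [u]; when it turns on, the new term
    [u - a] is negative. The stakes stand on both sides as sums, to avoid differences of
    integrals. *)
Lemma upcross_gain_step u a b t :
  upcross_gain u a b t.+1 + (below_then_above u a b t)%:R * u t <=
  upcross_gain u a b t + (below_then_above u a b t)%:R * u t.+1.
Proof.
rewrite /upcross_gain big_ord_recr /= mulrDr /upcross /=.
move: (\sum_(i < t) _) => s; move: (u t) (u t.+1) => x y.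
case: (below_then_above u a b t) => /=.
  by have [yb|yb] := leP y b; rewrite /= ?mulr1 ?mulr0 ?mul1r; lra.
by have [ya|ya] := ltP y a; rewrite /= ?mulr0 ?mul0r; lra.
Qed.

Lemma upcross_gain_ge u a b t : a <= b -> 0 <= u t -> 0 <= a ->
  (b - a) * \sum_(k < t) (upcross u a b k)%:R <= upcross_gain u a b t.
Proof.
move=> ab ut a0; rewrite /upcross_gain -addrA lerDl.
by case: ifP => _; lra.
Qed.

End upcrossings.

(** * The upcrossing inequality and the supermartingale convergence theorem *)

Section supermartingale.
Context {R : realType} {dO : measure_display} {Omega : measurableType dO}
  (P : probability Omega R) (G : nat -> set_system Omega).
Hypothesis sG : forall t, <<s G t >> `<=` (@measurable _ Omega).
Hypothesis ndG : forall t, <<s G t >> `<=` <<s G t.+1 >>.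

Definition adapted (t : nat) {d'} {T : measurableType d'} (h : Omega -> T) :=
  measurable_fun [set: g_sigma_algebraType (G t)] (h : g_sigma_algebraType (G t) -> T).

Lemma adaptedS t {d'} {T : measurableType d'} (h : Omega -> T) :
  adapted t h -> adapted t.+1 h.
Proof. by move=> mh mT B mB; apply: ndG; exact: mh. Qed.

Lemma adapted_le s t {d'} {T : measurableType d'} (h : Omega -> T) :
  (s <= t)%N -> adapted s h -> adapted t h.
Proof.
elim: t => [|t IH]; first by rewrite leqn0 => /eqP ->.
rewrite leq_eqVlt => /orP[/eqP -> //|]; rewrite ltnS => st mh.
by apply: adaptedS; exact: IH.
Qed.

Lemma adapted_measurable t {d'} {T : measurableType d'} (h : Omega -> T) :
  adapted t h -> measurable_fun [set: Omega] h.
Proof. exact: (measurable_fun_coarse (sG (t := t))). Qed.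

Variable X : nat -> Omega -> R.
Hypotheses (X0 : forall t w, 0 <= X t w) (mX : forall t, adapted t (X t))
  (EX0 : (\int[P]_w (X 0%N w)%:E < +oo)%E)
  (superX : forall t (phi : Omega -> R), adapted t phi -> (forall w, 0 <= phi w) ->
    (\int[P]_w (phi w * X t.+1 w)%:E <= \int[P]_w (phi w * X t w)%:E)%E).

Let mXO t : measurable_fun [set: Omega] (X t).
Proof. exact: adapted_measurable (@mX t). Qed.

Let EX t : (\int[P]_w (X t w)%:E <= \int[P]_w (X 0%N w)%:E)%E.
Proof.
elim: t => // t; apply: le_trans.
have := superX (measurable_cst (1 : R)) (fun=> ler01) (t := t).
by under eq_integral do rewrite mul1r; under [leRHS]eq_integral do rewrite mul1r.
Qed.

Section upcrossing_inequality.
Variables (a b : R).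
Hypotheses (a0 : 0 <= a) (ab : a < b).

Let H t w := below_then_above (X ^~ w) a b t.
Let gain t w := upcross_gain (X ^~ w) a b t.

Let mH t : adapted t (H t).
Proof.
elim: t => [|t IH]; first by apply: measurable_fun_ltr => //; exact: mX.
apply: measurable_fun_if => //; first exact: adaptedS.
  by apply/measurable_funTS/measurable_fun_ler => //; exact: mX.
by apply/measurable_funTS/measurable_fun_ltr => //; exact: mX.
Qed.

Let mHO t : measurable_fun [set: Omega] (H t).
Proof. exact: adapted_measurable (@mH t). Qed.

Let mup t : measurable_fun [set: Omega] (fun w => (upcross (X ^~ w) a b t)%:R : R).
Proof.
apply: (@measurableT_comp _ _ _ _ _ _ (fun c : bool => c%:R : R)) => //.
apply: measurable_and; first exact: (@mHO t).
by apply: measurable_neg; exact: (@mHO t.+1).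
Qed.

Let mgain t : measurable_fun [set: Omega] (gain t).
Proof.
apply: measurable_funD => //; apply: measurable_funD.
  apply: measurable_funM => //; exact: measurable_sum.
apply: measurable_fun_ifT => //; first exact: (@mHO t).
exact: measurable_funB.
Qed.

Let gain0 t w : 0 <= gain t w.
Proof.
apply: le_trans (@upcross_gain_ge _ (X ^~ w) a b t (ltW ab) (X0 t w) a0).
by rewrite mulr_ge0 ?subr_ge0 ?(ltW ab)// sumr_ge0.
Qed.

(** The state [H t] is adapted, so it is an admissible weight in [superX]. The integral [I t] of the
    stake is finite, which permits adding it to both sides and cancelling it. *)
Let Egain t : (\int[P]_w (gain t w)%:E <= a%:E)%E.
Proof.
elim: t => [|t].
  apply: (@le_trans _ _ (\int[P]_w (cst a%:E w))%E); last first.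
    by rewrite integral_cst//= probability_setT mule1.
  apply: ge0_le_integral => //=.
  - by move=> w _; rewrite lee_fin; exact: (gain0 0%N).
  - exact/measurable_EFinP.
  - move=> w _; rewrite lee_fin /gain /upcross_gain big_ord0 mulr0 add0r /=.
    by case: ifP => [h|_]; [rewrite subrK ltW|rewrite add0r].
apply: le_trans.
have mHR : adapted t (fun w => (H t w)%:R : R).
  by apply: (@measurableT_comp _ _ _ _ _ _ (fun c : bool => c%:R : R)) => //; exact: mH.
have mHRO := adapted_measurable mHR.
pose I k : \bar R := (\int[P]_w ((H t w)%:R * X k w)%:E)%E.
have mHX k : measurable_fun [set: Omega] (fun w => (H t w)%:R * X k w).
  exact: measurable_funM.
have I1 : (I t.+1 <= I t)%E by apply: superX.
have Ifin : I t \is a fin_num.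
  rewrite ge0_fin_numE; last by apply: integral_ge0 => w _; rewrite lee_fin mulr_ge0.
  apply: le_lt_trans (le_lt_trans (EX t) EX0); apply: ge0_le_integral => //=.
  - by move=> w _; rewrite lee_fin mulr_ge0.
  - exact/measurable_EFinP.
  - exact/measurable_EFinP.
  - by move=> w _; rewrite lee_fin ler_piMl//; case: (H t w).
have D s k : (\int[P]_w (gain s w + (H t w)%:R * X k w)%:E =
    \int[P]_w (gain s w)%:E + I k)%E.
  under eq_integral do rewrite EFinD.
  rewrite ge0_integralD//.
  - by move=> w _; rewrite lee_fin.
  - exact/measurable_EFinP.
  - by move=> w _; rewrite lee_fin mulr_ge0.
  - exact/measurable_EFinP.
rewrite -(leeD2rE _ _ Ifin) -D; apply: (@le_trans _ _ (\int[P]_w (gain t w)%:E + I t.+1)%E).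
  rewrite -D; apply: ge0_le_integral => //=.
  - by move=> w _; rewrite lee_fin addr_ge0// mulr_ge0.
  - by apply/measurable_EFinP; exact: measurable_funD.
  - by apply/measurable_EFinP; exact: measurable_funD.
  - by move=> w _; rewrite lee_fin; exact: upcross_gain_step.
exact: leeD2l.
Qed.

(** The expected number of upcrossings is at most [a / (b - a)], so this number is almost surely
    finite, and indicators that tend to zero are eventually zero. *)
Lemma ae_upcross_finite :
  \forall w \ae P, \forall t \near \oo, ~~ upcross (X ^~ w) a b t.
Proof.
pose c t w : \bar R := (upcross (X ^~ w) a b t)%:R%:E.
have c0 t w : (0 <= c t w)%E by rewrite lee_fin.
have mc t : measurable_fun [set: Omega] (c t) by exact/measurable_EFinP.
have ba : 0 < b - a by rewrite subr_gt0.
have part t : (\sum_(0 <= k < t) \int[P]_w c k w <= (a / (b - a))%:E)%E.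
  have mS : measurable_fun setT (fun w => \sum_(0 <= k < t) c k w)%E.
    exact: emeasurable_sum.
  have S0 w : (0 <= \sum_(0 <= k < t) c k w)%E by exact: sume_ge0.
  rewrite -ge0_integral_sum// mulrC EFinM lee_pdivlMl//.
  rewrite -(ge0_integralZl_EFin _ _ _ mS (ltW ba))//.
  apply: le_trans (Egain t); apply: ge0_le_integral => //=.
  - by move=> w _; rewrite mule_ge0// ?lee_fin ?(ltW ba)// sume_ge0.
  - by apply: emeasurable_funM => //; exact: emeasurable_sum.
  - exact/measurable_EFinP.
  - move=> w _; rewrite big_mkord /c sumEFin -EFinM lee_fin.
    exact: (@upcross_gain_ge _ (X ^~ w) a b t (ltW ab) (X0 t w) a0).
have S : (\int[P]_w (\sum_(0 <= k <oo) c k w) < +oo)%E.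
  rewrite integral_nneseries//; apply: le_lt_trans (ltry (a / (b - a))).
  apply: lime_le; first by apply: is_cvg_nneseries => n _ _; exact: integral_ge0.
  by apply: nearW => t; exact: part.
have iS : P.-integrable setT (fun w => \sum_(0 <= k <oo) c k w)%E.
  apply/integrableP; split; first exact: ge0_emeasurable_sum.
  by under eq_integral do rewrite gee0_abs ?nneseries_ge0//.
have := integrable_ae measurableT iS; apply: filterS => w /(_ I).
rewrite ge0_fin_numE; last exact: nneseries_ge0.
move=> /nnseries_is_cvg => /(_ (fun _ => ler0n _ _)) /cvg_series_cvg_0.
move=> /cvgrPdist_lt /(_ 1 ltr01); apply: filterS => t.
by rewrite sub0r normrN; case: (upcross _ _ _ _) => //; rewrite normr1 ltxx.
Qed.

End upcrossing_inequality.

(** By Fatou's lemma the liminf has an integral of at most that of [X 0], so it is almost surely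
    finite. *)
Lemma ae_liminf_lty :
  \forall w \ae P, exists M, forall N, exists2 t, (N <= t)%N & X t w <= M.
Proof.
have mE t : measurable_fun [set: Omega] (fun w => (X t w)%:E).
  exact/measurable_EFinP.
have F : (\int[P]_w limn_einf (fun t => (X t w)%:E) < +oo)%E.
  apply: le_lt_trans EX0; apply: le_trans (fatou _ _ _ _) _ => //.
    by move=> n w _; rewrite lee_fin.
  rewrite limn_einf_lim; apply: lime_le; first exact: is_cvg_einfs.
  apply: nearW => n; apply: le_trans (EX n); apply: ereal_inf_lbound.
  by exists n => /=.
have L0 w : (0 <= limn_einf (fun t => (X t w)%:E))%E.
  rewrite limn_einf_lim; apply: lime_ge; first exact: is_cvg_einfs.
  by apply: nearW => n; apply/ereal_infP => _ [k _ <-]; rewrite lee_fin.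
have iL : P.-integrable setT (fun w => limn_einf (fun t => (X t w)%:E)).
  apply/integrableP; split.
    rewrite (_ : (fun w => _) = (fun w => - limn_esup (fun t => - (X t w)%:E))%E).
      apply: measurableT_comp => //; apply: measurable_fun_limn_esup => n.
      exact: measurableT_comp.
    apply/funext => w; rewrite -limn_einfN; congr limn_einf.
    by apply/funext => t /=; rewrite opprK.
  by under eq_integral do rewrite gee0_abs//.
have := integrable_ae measurableT iL; apply: filterS => w /(_ I) fin.
apply: contrapT => /forallNP H.
have : (X t w)%:E @[t --> \oo] --> +oo%E.
  apply/cvgeryP/cvgryPge => M; have /existsNP[N HN] := H M.
  exists N => // t /= Nt; rewrite leNgt; apply/negP => tM.
  by apply: HN; exists t => //; exact: ltW.
move=> /cvg_limn_einf_sup[E _]; by move: fin; rewrite E.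
Qed.

Lemma supermartingale_cvg : \forall w \ae P, cvg (X t w @[t --> \oo]).
Proof.
pose D (q : rat * rat) w := q.1 < q.2 -> 0 < (ratr q.1 : R) ->
  \forall t \near \oo, ~~ upcross (X ^~ w) (ratr q.1) (ratr q.2) t.
(* The pairs of rationals are enumerated by [pickle], so that one null set serves for all of
   them. *)
have HD : \forall w \ae P, forall n : nat,
    if @choice.unpickle (rat * rat)%type n is Some q then D q w else True.
  apply: ae_foralln => n; case: choice.unpickle => [[p q]|]; last exact: nearW.
  have [pq|pq] := boolP (p < q); last by apply: nearW => w; rewrite /D /= (negbTE pq).
  have [p0|p0] := ltP 0 (ratr p : R); last first.
    by apply: nearW => w _ /= /lt_le_trans /(_ p0); rewrite ltxx.
  have := @ae_upcross_finite (ratr p) (ratr q) (ltW p0).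
  by rewrite ltr_rat => /(_ pq); apply: filterS => w ? _ _.
move: HD ae_liminf_lty; apply: filterS2 => w hD hM.
apply: cvg_of_upcross => // p q pq p0.
by have := hD (choice.pickle (p, q)); rewrite choice.pickleK; exact.
Qed.

End supermartingale.

(** * The Robbins-Siegmund theorem *)

Section robbins_siegmund.
Context {R : realType}.
Implicit Types (a b v : nat -> R).

Definition growth a (t : nat) : R := \prod_(k < t) (1 + a k).

(** Dividing by [growth] cancels the factors [1 + a t], and the discounted sum restores what was
    dissipated: under the drift inequality this is a supermartingale. The index [k.+1] fits because
    [b t] occurs together with [v t.+1]. *)
Definition compensated v a b (t : nat) : R :=
  v t / growth a t + \sum_(k < t) b k / growth a k.+1.

Lemma growth_ge1 a t : (forall k, 0 <= a k) -> 1 <= growth a t.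
Proof.
move=> a0; elim: t => [|t IH]; first by rewrite /growth big_ord0.
rewrite /growth big_ord_recr /= -[leLHS]mulr1; apply: ler_pM => //.
by rewrite lerDl.
Qed.

Lemma growthS a t : growth a t.+1 = growth a t * (1 + a t).
Proof. by rewrite /growth big_ord_recr. Qed.

Lemma nondecreasing_growth a : (forall k, 0 <= a k) ->
  nondecreasing_seq (growth a).
Proof.
move=> a0; apply/nondecreasing_seqP => t.
rewrite growthS ler_peMr ?lerDl//.
exact: le_trans ler01 (growth_ge1 t a0).
Qed.

Lemma cvg_growth a : (forall k, 0 <= a k) -> cvgn (series a) -> cvgn (growth a).
Proof.
move=> a0 ca; apply: nondecreasing_is_cvgn; first exact: nondecreasing_growth.
have sa0 : nondecreasing_seq (series a).
  by apply: nondecreasing_series => k _ _; exact: a0.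
exists (expR (limn (series a))) => _ [t _ <-].
apply: (@le_trans _ _ (expR (series a t))); last first.
  by rewrite ler_expR; exact: nondecreasing_cvgn_le.
rewrite /series /= big_mkord; elim: t => [|t IH].
  by rewrite /growth !big_ord0 expR0.
rewrite growthS big_ord_recr /= expRD; apply: ler_pM => //.
- exact: le_trans ler01 (growth_ge1 t a0).
- by rewrite addr_ge0.
- exact: expR_ge1Dx.
Qed.

(** The discounted sums of [b] are nondecreasing and bounded by the compensated sequence; the
    convergent sequence [growth a] then undoes the discounting. *)
Lemma compensated_cvg v a b :
  (forall t, 0 <= v t) -> (forall t, 0 <= a t) -> (forall t, 0 <= b t) ->
  cvgn (series a) -> cvgn (compensated v a b) ->
  cvgn v /\ cvgn (series b).
Proof.
move=> v0 a0 b0 ca cW.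
have cG := cvg_growth a0 ca.
have G0 t : 0 < growth a t by exact: lt_le_trans ltr01 (growth_ge1 t a0).
pose S t := \sum_(k < t) b k / growth a k.+1.
have bG0 k : 0 <= b k / growth a k.+1 by rewrite divr_ge0// ltW.
have ndS : nondecreasing_seq S.
  by apply/nondecreasing_seqP => t; rewrite /S big_ord_recr /= lerDl.
have [M MW] : exists M, forall t, compensated v a b t <= M.
  have [M [_ HM]] := cvg_seq_bounded cW.
  exists (M + 1) => t; apply: le_trans (ler_norm _) _.
  by apply: HM; rewrite ?ltrDl.
have SW t : S t <= compensated v a b t by rewrite lerDr divr_ge0// ltW.
have cS : cvgn S.
  apply: nondecreasing_is_cvgn => //; exists M => _ [t _ <-].
  exact: le_trans (SW t) (MW t).
have vE : v = (fun t => growth a t * (compensated v a b t - S t)).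
  apply/funext => t; rewrite /compensated addrK mulrC divfK// gt_eqF//.
split.
  have cWS : cvgn (fun t => compensated v a b t - S t) by exact: is_cvgB.
  suff : cvgn (fun t => growth a t * (compensated v a b t - S t)) by rewrite -vE.
  apply/cvg_ex; exists (limn (growth a) * limn (fun t => compensated v a b t - S t)).
  exact: cvgM.
apply: nondecreasing_is_cvgn.
  by apply: nondecreasing_series => k _ _; exact: b0.
have Gl k : growth a k <= limn (growth a).
  by apply: nondecreasing_cvgn_le => //; exact: nondecreasing_growth.
exists (limn (growth a) * M) => _ [t _ <-].
apply: (@le_trans _ _ (limn (growth a) * S t)); last first.
  rewrite ler_wpM2l ?(le_trans (SW t))//.
  exact: le_trans (ltW (G0 0%N)) (Gl 0%N).
rewrite /series /= big_mkord mulr_sumr; apply: ler_sum => k _.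
rewrite mulrA ler_pdivlMr// mulrC ler_wpM2r//.
Qed.

Context {dO : measure_display} {Omega : measurableType dO}
  (P : probability Omega R) (G : nat -> set_system Omega).
Hypothesis sG : forall t, <<s G t >> `<=` (@measurable _ Omega).
Hypothesis ndG : forall t, <<s G t >> `<=` <<s G t.+1 >>.

(* The drift inequality is the conditional one
   [E[V t.+1 | F_t] + b t <= (1 + a t) V t], tested against nonnegative
   [F_t]-measurable weights. *)
Lemma robbins_siegmund (V a b : nat -> Omega -> R) :
  (forall t w, 0 <= V t w) -> (forall t w, 0 <= a t w) -> (forall t w, 0 <= b t w) ->
  (forall t, adapted G t (V t)) -> (forall t, adapted G t (a t)) ->
  (forall t, adapted G t (b t)) ->
  (\int[P]_w (V 0%N w)%:E < +oo)%E ->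
  (forall t (phi : Omega -> R), adapted G t phi -> (forall w, 0 <= phi w) ->
    (\int[P]_w (phi w * (V t.+1 w + b t w))%:E <=
     \int[P]_w (phi w * ((1 + a t w) * V t w))%:E)%E) ->
  \forall w \ae P, cvgn (series (a ^~ w)) ->
    cvg (V t w @[t --> \oo]) /\ cvgn (series (b ^~ w)).
Proof.
move=> V0 a0 b0 mV ma mb EV0 drift.
pose g t w := growth (a ^~ w) t.
have g0 t w : 0 < g t w by apply: lt_le_trans ltr01 (growth_ge1 _ _) => k.
pose W t w := compensated (V ^~ w) (a ^~ w) (b ^~ w) t.
(* [g t.+1] is already known at time [t], as it involves only [a 0] to [a t]; its inverse may
   therefore enter the weights. *)
have mg t : adapted G t (g t.+1).
  elim: t => [|t IH].
    rewrite (_ : g 1%N = fun w => 1 + a 0%N w).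
      by apply: measurable_funD => //; exact: (@ma 0%N).
    by apply/funext => w; rewrite /g /growth big_ord_recr big_ord0 /= mul1r.
  rewrite (_ : g t.+2 = fun w => g t.+1 w * (1 + a t.+1 w)).
    apply: measurable_funM; first exact: (adaptedS ndG).
    by apply: measurable_funD => //; exact: ma.
  by apply/funext => w; rewrite /g growthS.
have mginv t : adapted G t (fun w => (g t.+1 w)^-1).
  rewrite (_ : (fun w => _) = fun w => g t.+1 w `^ (-1)).
    apply: (@measurableT_comp _ _ _ _ _ _ (fun x : R => x `^ (-1))).
      exact: measurable_powR.
    exact: mg.
  by apply/funext => w; rewrite powR_inv1// ltW.
have mS t : adapted G t (fun w => \sum_(k < t.+1) b k w / g k.+1 w).
  apply: measurable_sum => k; apply: (adapted_le ndG (_ : (k <= t)%N)).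
    by rewrite -ltnS.
  by apply: measurable_funM; [exact: mb|exact: mginv].
have mW t : adapted G t (W t).
  case: t => [|t].
    rewrite (_ : W 0%N = V 0%N); first exact: mV.
    by apply/funext => w; rewrite /W /compensated /growth !big_ord0 divr1 addr0.
  apply: measurable_funD; last exact: (adaptedS ndG).
  by apply: measurable_funM; [exact: mV|exact: (adaptedS ndG)].
have bg0 t w : 0 <= \sum_(k < t) b k w / g k.+1 w.
  by apply: sumr_ge0 => k _; rewrite divr_ge0// ltW.
have W0 t w : 0 <= W t w.
  by apply: addr_ge0; [rewrite divr_ge0// ltW//; exact: g0|exact: bg0].
have mO t (h : Omega -> R) : adapted G t h -> measurable_fun setT h.
  exact: (adapted_measurable sG).
have : \forall w \ae P, cvg (W t w @[t --> \oo]).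
  apply: (supermartingale_cvg sG ndG) => //.
    rewrite (_ : (fun w => (W 0%N w)%:E) = fun w => (V 0%N w)%:E)//.
    by apply/funext => w; rewrite /W /compensated /growth !big_ord0 divr1 addr0.
  move=> t phi mphi phi0.
  (* With this weight the drift inequality becomes the supermartingale inequality, up to the common
     term in [S]. *)
  pose psi w := phi w / g t.+1 w.
  pose S w := \sum_(k < t) b k w / g k.+1 w.
  have psi0 w : 0 <= psi w by rewrite divr_ge0// ltW.
  have mpsi : adapted G t psi by apply: measurable_funM => //; exact: mginv.
  have mSt : adapted G t S.
    rewrite /S; case: (t) => [|t']; last by apply: (adaptedS ndG); exact: mS.
    by under eq_fun do rewrite big_ord0; exact: measurable_cst.
  have E1 : (\int[P]_w (phi w * W t.+1 w)%:E =
      \int[P]_w (psi w * (V t.+1 w + b t w))%:E + \int[P]_w (phi w * S w)%:E)%E.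
    rewrite -ge0_integralD//.
    - apply: eq_integral => w _; rewrite -EFinD; congr EFin.
      by rewrite /W /compensated big_ord_recr /= /psi /S -/(g t.+1 w); ring.
    - by move=> w _; rewrite lee_fin mulr_ge0// addr_ge0.
    - apply/measurable_EFinP/measurable_funM; first exact: mO mpsi.
      by apply: measurable_funD; [exact: mO (@mV _)|exact: mO (@mb _)].
    - by move=> w _; rewrite lee_fin mulr_ge0//; exact: bg0.
    - by apply/measurable_EFinP/measurable_funM; [exact: mO mphi|exact: mO mSt].
  have E2 : (\int[P]_w (phi w * W t w)%:E =
      \int[P]_w (psi w * ((1 + a t w) * V t w))%:E + \int[P]_w (phi w * S w)%:E)%E.
    rewrite -ge0_integralD//.
    - apply: eq_integral => w _; rewrite -EFinD; congr EFin.
      rewrite /W /compensated /psi /S -/(g t w) /g growthS -/(g t w).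
      field; rewrite (gt_eqF (g0 t w))/=.
      by rewrite gt_eqF// ltr_wpDr.
    - move=> w _; rewrite lee_fin; apply: mulr_ge0; first exact: psi0.
      by apply: mulr_ge0 => //; exact: addr_ge0.
    - apply/measurable_EFinP/measurable_funM; first exact: mO mpsi.
      apply: measurable_funM; last exact: mO (@mV _).
      by apply: measurable_funD => //; exact: mO (@ma _).
    - by move=> w _; rewrite lee_fin mulr_ge0//; exact: bg0.
    - by apply/measurable_EFinP/measurable_funM; [exact: mO mphi|exact: mO mSt].
  by rewrite E1 E2; apply: leeD2r; exact: drift.
by apply: filterS => w cW ca; exact: (compensated_cvg _ _ _ ca cW).
Qed.

End robbins_siegmund.

(** * Convergence of trajectories *)

Section sequences_lemmas.
Context {R : realType}.
Implicit Types (a b u : nat -> R).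

Lemma cvg0_powR p u : 0 < p -> (forall t, 0 <= u t) ->
  u t @[t --> \oo] --> 0 -> u t `^ p @[t --> \oo] --> 0.
Proof.
move=> p0 u0 /cvgr0Pnorm_le cu; apply/cvgr0Pnorm_le => e e0.
have e'0 : 0 < e `^ p^-1 by exact: powR_gt0.
have := cu _ e'0; apply: filterS => t; rewrite !ger0_norm ?powR_ge0// => H.
apply: le_trans (ler_powR_base (ltW p0) (u0 t) H) _.
by rewrite -powRrM mulVf ?gt_eqF// powRr1// ltW.
Qed.

Lemma powR_cvg0_inv p u : 0 < p -> (forall t, 0 <= u t) ->
  u t `^ p @[t --> \oo] --> 0 -> u t @[t --> \oo] --> 0.
Proof.
move=> p0 u0 cu; rewrite (_ : u = fun t => (u t `^ p) `^ p^-1).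
  by apply: cvg0_powR; rewrite ?invr_gt0// => t; exact: powR_ge0.
by apply/funext => t; rewrite -powRrM divff ?gt_eqF// powRr1.
Qed.

Lemma near_le_series_cvg a b : (forall t, 0 <= a t) -> (forall t, 0 <= b t) ->
  (\forall t \near \oo, a t <= b t) -> cvgn (series b) -> cvgn (series a).
Proof.
move=> a0 b0 [N _ ab] cb; rewrite -(is_cvg_series_restrict N).
apply: nondecreasing_is_cvgn; first by apply: nondecreasing_series => k _ _.
exists (limn (series b)) => _ [t _ <-] /=.
apply: (@le_trans _ _ (series b t)); last first.
  by apply: nondecreasing_cvgn_le => //; apply: nondecreasing_series => k _ _.
have [tN|Nt] := leqP t N.
  by rewrite big_geq// /series sumr_ge0.
rewrite /series /= (big_cat_nat (leq0n N) (ltnW Nt)) /=.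
apply: (@le_trans _ _ (\sum_(N <= i < t) b i)); last by rewrite lerDr sumr_ge0.
rewrite !big_nat; apply: ler_sum => k /andP[Nk _]; exact: ab.
Qed.

Lemma cvgn_cauchy (V : normedModType R) (u : nat -> V) e : cvgn u -> 0 < e ->
  exists N, forall m n, (N <= m)%N -> (N <= n)%N -> `|u m - u n| <= e.
Proof.
move=> /cvgrPdist_le /(_ (e / 2)) cu e0.
have [N _ H] := cu (divr_gt0 e0 (ltr0n R 2)).
exists N => m n Nm Nn; rewrite (splitr e).
apply: le_trans (ler_distD (limn u) _ _) _; apply: lerD; last exact: H.
by rewrite distrC; exact: H.
Qed.

Lemma cvg_rowP {d : nat} (M : nat -> 'rV[R]_d) :
  (forall i, cvgn (fun t => M t 0 i)) -> cvgn M.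
Proof.
move=> cM; apply/cvg_ex; exists (\row_i limn (fun t => M t 0 i)).
apply/cvgrPdist_le => e e0.
have : \forall t \near \oo, forall i, `|limn (fun t => M t 0 i) - M t 0 i| <= e.
  by apply: filter_forall => i; move/cvgrPdist_le : (cM i) => /(_ e e0).
apply: filterS => t H; rewrite [leLHS]/Num.norm /= mx_normrE.
apply/bigmax_leP; split => [|[i j] _ /=]; first exact: ltW.
by rewrite ord1 !mxE.
Qed.

(* The increments tend to zero, so the sequence cannot jump over a thin shell
   around a cluster point, and it leaves such shells because [h] does not
   vanish there. *)
Lemma cvg_finite_zeros {d : nat} (x : nat -> 'rV[R]_d) (h f : 'rV[R]_d -> R) (r a b : R) :
  (forall t, `|x t| <= r) -> (x t.+1 - x t) @[t --> \oo] --> (0 : 'rV[R]_d) ->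
  continuous h -> continuous f -> h (x t) @[t --> \oo] --> 0 ->
  (forall t, a <= f (x t) <= b) ->
  finite_set [set y | a <= f y <= b /\ h y = 0] ->
  cvgn x.
Proof.
move=> xr dx ch cf hx fx fin.
pose K : set 'rV[R]_d := [set y | `|y| <= r].
have cnorm : continuous (fun y : 'rV[R]_d => `|y|) by move=> y; exact: norm_continuous.
have closedK : closed K by exact: ((continuous_closedP _).1 cnorm _ (@closed_le R r)).
have compactK : compact K.
  apply: bounded_closed_compact => //; exists r; split; first exact: num_real.
  by move=> M rM y /= yr; exact: le_trans yr (ltW rM).
have [p [Kp clp]] : K `&` cluster (x t @[t --> \oo]) !=set0.
  by apply: compactK; exists 0%N => // t _ /=; exact: xr.
(* Finitely many zeros in the strip leave a ball around [p] that contains none of them, except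
   possibly [p]. *)
have [d0 d00 iso] : exists2 d0, 0 < d0 & forall y, a <= f y <= b -> h y = 0 ->
    `|y - p| < d0 -> y = p.
  move/finite_seqP : fin => [s sE].
  have H (s' : seq 'rV[R]_d) : exists2 d0 : R, 0 < d0 &
      forall y, y \in s' -> `|y - p| < d0 -> y = p.
    elim: s' => [|y s' [d1 d10 IH]]; first by exists 1.
    have [->|yp] := eqVneq y p.
      by exists d1 => // y'; rewrite inE => /orP[/eqP ->|/IH].
    exists (Num.min d1 `|y - p|).
      by rewrite lt_min d10 normr_gt0 subr_eq0.
    move=> y'; rewrite inE lt_min => /orP[/eqP ->|ys /andP[? _]]; last exact: IH.
    by rewrite ltxx andbF.
  have [d0 d00 Hd] := H s; exists d0 => // y y1 y2; apply: Hd.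
  have : [set y | a <= f y <= b /\ h y = 0] y by split.
  by rewrite sE.
apply/cvg_ex; exists p; apply/cvgrPdist_le => e e0.
(* With a third of the radius, the shell between [dl] and [2 * dl] lies in the isolating ball, and a
   step shorter than [dl] cannot cross it. *)
pose dl := Num.min e d0 / 3.
have dl0 : 0 < dl by rewrite divr_gt0// lt_min e0 d00.
have dle : dl <= e.
  rewrite ler_pdivrMr//; apply: (@le_trans _ _ e); first by rewrite ge_min lexx.
  by lra.
have dld0 : 2 * dl < d0.
  rewrite /dl mulrA ltr_pdivrMr//; have : Num.min e d0 <= d0 by rewrite ge_min lexx orbT.
  by move: d00; lra.
pose Q : set 'rV[R]_d :=
  K `&` ([set y | dl <= `|y - p|] `&` ([set y | `|y - p| <= 2 * dl] `&`
   ([set y | a <= f y] `&` [set y | f y <= b]))).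
have cdist : continuous (fun y : 'rV[R]_d => `|y - p|).
  move=> y; apply: continuous_comp; last exact: norm_continuous.
  exact: (@cvgB _ _ _ (nbhs y) _ id (cst p) y p cvg_id (cvg_cst p)).
have compactQ : compact Q.
  apply: (@subclosed_compact _ Q K) => //; last by move=> y [].
  apply: closedI => //; apply: closedI.
    exact: ((continuous_closedP _).1 cdist _ (@closed_ge R dl)).
  apply: closedI.
    exact: ((continuous_closedP _).1 cdist _ (@closed_le R (2 * dl))).
  apply: closedI.
    exact: ((continuous_closedP _).1 cf _ (@closed_ge R a)).
  exact: ((continuous_closedP _).1 cf _ (@closed_le R b)).
(* On the compact shell [|h|] has a positive minimum, since the only possible zero [p] lies inside
   the inner sphere; as [h (x t)] tends to zero, the shell is eventually avoided. *)
have notQ : \forall t \near \oo, ~ Q (x t).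
  have [[y0 Qy0]|Q0] := pselect (Q !=set0); last first.
    by apply: nearW => t Qt; apply: Q0; exists (x t).
  have [|c Qc Hc] := @compact_EVT_min _ R (fun y => `|h y|) Q (ex_intro _ y0 Qy0) compactQ.
    apply: continuous_subspaceT => y; apply: continuous_comp; first exact: ch.
    exact: norm_continuous.
  have hc : 0 < `|h c|.
    rewrite normr_gt0; apply/eqP => hc0; move: Qc; rewrite inE => -[_ [/= c1 [c2 [c3 c4]]]].
    have cp : c = p.
      by apply: iso => //; [rewrite c3 c4|exact: le_lt_trans c2 dld0].
    by move: c1; rewrite cp subrr normr0 leNgt dl0.
  move/cvgrPdist_lt : hx => /(_ _ hc); apply: filterS => t; rewrite sub0r normrN => ht Qt.
  by have := Hc (x t); rewrite inE => /(_ Qt); rewrite leNgt ht.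
have near_dx : \forall t \near \oo, `|x t.+1 - x t| < dl.
  by move/cvgr0Pnorm_lt : dx; exact.
have [N _ HN] : \forall t \near \oo, ~ Q (x t) /\ `|x t.+1 - x t| < dl.
  exact: filterI.
have [t Nt xt] : exists2 t, (N <= t)%N & `|x t - p| < dl.
  have A : nbhs (x t @[t --> \oo]) [set y | exists2 t, (N <= t)%N & y = x t].
    by exists N => // t /= Nt; exists t.
  have B : nbhs p [set y | `|y - p| < dl].
    apply/nbhs_ballP; exists dl => // y; rewrite -ball_normE /= distrC; exact.
  by have [_ [[t Nt ->] ?]] := clp _ _ A B; exists t.
exists t => // n /= tn; apply: le_trans dle; rewrite distrC ltW//.
elim: n tn => [|n IH]; first by rewrite leqn0 => /eqP t0; rewrite t0 in xt.
rewrite leq_eqVlt => /orP[/eqP tn|]; first by rewrite tn in xt.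
rewrite ltnS => tn.
have [_ dn] := HN n (leq_trans Nt tn).
have [nQ _] := HN n.+1 (leq_trans Nt (leqW tn)).
rewrite ltNge; apply/negP => H; apply: nQ; split; first exact: xr.
have /andP[f1 f2] := fx n.+1; split => //; split => //=.
apply: le_trans (ler_distD (x n) _ _) _.
by have := IH tn; move: dn; lra.
Qed.

End sequences_lemmas.

(** * Pathwise analysis of a perturbed gradient method *)

Section trajectory.
Context {R : realType} {d : nat}.
Variables (f : 'rV[R]_d -> R) (alpha A c q : R).
Hypotheses (fdiff : forall x, differentiable f x)
  (halpha : 0 < alpha <= 1) (hA : 0 < A)
  (fholder : forall z z' : 'rV[R]_d,
     enorm (gradient f z - gradient f z') <= A * enorm (z - z') `^ alpha)
  (c0 : 0 <= c) (q0 : 0 < q).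

Let alpha0 : 0 < alpha. Proof. by case/andP: halpha. Qed.

Variables (z v x e : nat -> 'rV[R]_d) (r : nat -> R).
Hypotheses (xE : forall t, x t = z t - c *: v t)
  (zS : forall t, z t.+1 = z t - (r t / q) *: (gradient f (x t) + e t))
  (r0 : forall t, 0 <= r t) (rdiv : ~ cvgn (series r)) (rcvg : r t @[t --> \oo] --> 0)
  (fz : cvgn (fun t => f (z t))) (vcvg : enorm (v t) @[t --> \oo] --> 0)
  (diss : cvgn (series (fun t => r t * enorm (gradient f (z t)) ^+ 2)))
  (noise : forall i, cvgn (fun t => \sum_(k < t) r k * e k 0 i)).

Let g t := enorm (gradient f (z t)).
Let M t : 'rV[R]_d := \row_i \sum_(k < t) r k * e k 0 i.
Let S := series (fun t => r t * g t ^+ 2).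

Let MS t : M t.+1 = M t + r t *: e t.
Proof. by apply/rowP => i; rewrite !mxE big_ord_recr. Qed.

Let cvgM' : cvgn M.
Proof.
apply: cvg_rowP => i; rewrite (_ : (fun t => M t 0 i) = fun t => \sum_(k < t) r k * e k 0 i).
  exact: noise.
by apply/funext => t; rewrite mxE.
Qed.

Let xz t : enorm (gradient f (x t) - gradient f (z t)) <= A * (c * enorm (v t)) `^ alpha.
Proof.
apply: le_trans (fholder _ _) _.
by rewrite xE addrAC subrr add0r enormN enormZ ger0_norm.
Qed.

Let xz_cvg : A * (c * enorm (v t)) `^ alpha @[t --> \oo] --> 0.
Proof.
rewrite -(mulr0 A); apply: cvgM; first exact: cvg_cst.
apply: cvg0_powR => // [t|]; first by rewrite mulr_ge0 ?enorm_ge0.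
by rewrite -(mulr0 c); apply: cvgM; [exact: cvg_cst|exact: vcvg].
Qed.

(** Adding [q^-1 *: M t] to [z t] removes the noise: the sum moves by an exact gradient step. *)
Let step t : z t.+1 - z t + q^-1 *: (M t.+1 - M t) = - ((r t / q) *: gradient f (x t)).
Proof.
rewrite MS zS; apply/rowP => i; rewrite !mxE; ring.
Qed.

(** Otherwise [r t] would eventually be at most [r t * g t ^+ 2 / dl ^+ 2], which is summable,
    against the divergence of the stepsizes. *)
Let small_gradient_often dl : 0 < dl -> forall N, exists2 t, (N <= t)%N & g t < dl.
Proof.
move=> dl0 N; apply: contrapT => H; apply: rdiv.
have H' t : (N <= t)%N -> dl <= g t.
  by move=> Nt; rewrite leNgt; apply/negP => gt; apply: H; exists t.
apply: (@near_le_series_cvg _ _ (fun t => (dl ^+ 2)^-1 * (r t * g t ^+ 2))).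
- exact: r0.
- by move=> t; rewrite mulr_ge0 ?invr_ge0 ?sqr_ge0// mulr_ge0 ?sqr_ge0.
- exists N => // t /= /H' dg; rewrite mulrC -ler_pdivrMr ?invr_gt0 ?exprn_gt0//.
  by rewrite invrK ler_wpM2l// ler_pXn2r ?nnegrE ?enorm_ge0// ltW.
rewrite (_ : series _ = fun t => (dl ^+ 2)^-1 * S t).
  apply/cvg_ex; exists ((dl ^+ 2)^-1 * limn S).
  by apply: cvgM; [exact: cvg_cst|exact: diss].
by apply/funext => t; rewrite /S /series /= mulr_sumr.
Qed.

(* After its last visit below [dl] the gradient stays comparable to
   [g ^+ 2 / dl], whose weighted sum has small tails, so the iterate hardly
   moves and the gradient cannot reach [2 * dl]. *)
Lemma gradient_aux_cvg : g t @[t --> \oo] --> 0.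
Proof.
apply/cvgr0Pnorm_le => e0 e00.
pose dl := e0 / 2; have dl0 : 0 < dl by rewrite divr_gt0.
(* Over a distance [rho] the gradient changes by at most [A rho^alpha = dl]. *)
pose rho := (dl / A) `^ alpha^-1.
have rho0 : 0 < rho by rewrite powR_gt0// divr_gt0.
have rhoE : A * rho `^ alpha = dl.
  rewrite -powRrM mulVf ?gt_eqF// powRr1 ?divr_ge0 ?ltW//.
  by rewrite mulrC divfK// gt_eqF.
(* Three contributions of size [eta] will add up to [q * rho]: the first step after the last small
   gradient, the tail of the dissipation and the noise. *)
pose eta := q * rho / 3.
have eta0 : 0 < eta by rewrite divr_gt0// mulr_gt0.
have [N1 _ H1] : \forall t \near \oo, A * (c * enorm (v t)) `^ alpha <= dl.
  move/cvgr0Pnorm_le : xz_cvg => /(_ _ dl0); apply: filterS => t.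
  exact: le_trans (ler_norm _).
have [N2 H2] := cvgn_cauchy diss (divr_gt0 (mulr_gt0 eta0 dl0) (ltr0n R 2)).
have [N3 H3] := cvgn_cauchy cvgM' (divr_gt0 eta0 (ltr0Sn R d)).
have [N4 _ H4] : \forall t \near \oo, r t <= eta / (2 * dl).
  have eta4 : 0 < eta / (2 * dl) by rewrite divr_gt0// mulr_gt0.
  move/cvgr0Pnorm_le : rcvg => /(_ _ eta4); apply: filterS => t.
  exact: le_trans (ler_norm _).
pose N := maxn (maxn N1 N2) (maxn N3 N4).
have [t0 Nt0 gt0] := small_gradient_often dl0 N.
move: Nt0; rewrite !geq_max => /andP[/andP[Nt1 Nt2] /andP[Nt3 Nt4]].
have gx t : (t0 <= t)%N -> enorm (gradient f (x t)) <= dl + g t.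
  move=> tt; rewrite -lerBlDr; apply: le_trans (enormB _ _) _.
  by apply: le_trans (xz t) (H1 _ _) => /=; exact: leq_trans tt.
(* [m] is the last time before [t] with gradient below [dl] (and [t0] at the start). The term in
   [r m] pays for the step made at time [m], the tail of [S] for all later ones. *)
pose Inv t := exists m, [/\ (t0 <= m <= t)%N, g m < dl &
    enorm (z t - z m + q^-1 *: (M t - M m)) <=
    q^-1 * (2 * dl * r m + 2 / dl * (S t - S m))].
have base : Inv t0.
  exists t0; rewrite leqnn; split => //.
  rewrite !subrr scaler0 addr0 enorm0 mulr0 addr0.
  by rewrite mulr_ge0 ?invr_ge0 ?(ltW q0)// mulr_ge0// mulr_ge0// ltW.
have inv t : (t0 <= t)%N -> Inv t.
  elim: t => [|t IH].
    by rewrite leqn0 => /eqP t00; rewrite t00 in base.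
  rewrite leq_eqVlt => /orP[/eqP tt|]; first by rewrite -tt.
  rewrite ltnS => tt.
  have SS : S t.+1 = S t + r t * g t ^+ 2 by rewrite /S /series /= big_nat_recr.
  have st : enorm (z t.+1 - z t + q^-1 *: (M t.+1 - M t)) <= q^-1 * (r t * (dl + g t)).
    rewrite step enormN enormZ ger0_norm ?divr_ge0 ?(ltW q0)//.
    by rewrite (mulrC (r t)) -mulrA ler_wpM2l ?invr_ge0 ?(ltW q0)// ler_wpM2l// gx.
  have q1 : 0 <= q^-1 by rewrite invr_ge0 ltW.
  have [gd|gd] := ltP (g t) dl.
    exists t; split => //; first by rewrite tt ltnW.
    apply: le_trans st _; rewrite ler_wpM2l// SS addrAC subrr add0r.
    apply: (@le_trans _ _ (2 * dl * r t)).
      by rewrite (mulrC (2 * dl)); apply: (ler_wpM2l (r0 t)); lra.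
    rewrite lerDl; apply: mulr_ge0; first by rewrite divr_ge0 ?(ltW dl0).
    exact: mulr_ge0 (r0 t) (sqr_ge0 _).
  have [m [/andP[tm mt] gm Hm]] := IH tt.
  exists m; split => //; first by rewrite tm ltnW.
  have -> : z t.+1 - z m + q^-1 *: (M t.+1 - M m) =
      (z t - z m + q^-1 *: (M t - M m)) + (z t.+1 - z t + q^-1 *: (M t.+1 - M t)).
    by apply/rowP => i; rewrite !mxE; ring.
  apply: le_trans (enormD _ _) _; apply: le_trans (lerD Hm st) _.
  rewrite -mulrDr; apply: ler_wpM2l => //.
  have -> : 2 * dl * r m + 2 / dl * (S t.+1 - S m) =
    2 * dl * r m + 2 / dl * (S t - S m) + r t * (2 / dl * g t ^+ 2) by rewrite SS; ring.
  rewrite lerD2l; apply: (ler_wpM2l (r0 t)).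
  (* Here [dl <= g t], hence [dl + g t <= 2 * g t <= 2 / dl * g t ^+ 2]. *)
  apply: (@le_trans _ _ (2 * g t)); first by rewrite mulr_natl mulr2n lerD2r.
  rewrite -mulrA ler_wpM2l// mulrC ler_pdivlMr// expr2 ler_wpM2l// enorm_ge0//.
exists t0 => // t /= tt; rewrite ger0_norm ?enorm_ge0//.
have [m [/andP[tm mt] gm Hm]] := inv t tt.
have zm : enorm (z t - z m) <= rho.
  have -> : z t - z m = (z t - z m + q^-1 *: (M t - M m)) - q^-1 *: (M t - M m).
    by rewrite addrK.
  apply: le_trans (enormD _ _) _; rewrite enormN enormZ ger0_norm ?invr_ge0 ?(ltW q0)//.
  apply: le_trans (lerD Hm (lexx _)) _; rewrite -mulrDr mulrC ler_pdivrMr//.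
  have h1 : 2 * dl * r m <= eta.
    rewrite mulrC -ler_pdivlMr ?mulr_gt0//; apply: H4; exact: leq_trans tm.
  have h2 : 2 / dl * (S t - S m) <= eta.
    rewrite mulrC mulrA ler_pdivrMr// mulrC mulrC -ler_pdivlMr//.
    apply: le_trans (ler_norm _) (H2 _ _ _ _); first exact: leq_trans tt.
    exact: leq_trans tm.
  have h3 : enorm (M t - M m) <= eta.
    apply: le_trans (enorm_le_norm _) _.
    apply: (@le_trans _ _ (d.+1%:R * `|M t - M m|)).
      by rewrite ler_wpM2r// ler_nat.
    rewrite mulrC -ler_pdivlMr ?ltr0n//; apply: H3; first exact: leq_trans tt.
    exact: leq_trans tm.
  have : eta + eta + eta = q * rho by rewrite /eta; field.
  by rewrite (mulrC rho); lra.
have gtm : g t <= g m + dl.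
  rewrite -lerBlDl; apply: le_trans (enormB _ _) _; apply: le_trans (fholder _ _) _.
  rewrite -rhoE ler_wpM2l ?(ltW hA)//; apply: ler_powR_base => //; first exact: ltW.
  exact: enorm_ge0.
by rewrite (splitr e0) -/dl; apply: le_trans gtm _; rewrite lerD2r ltW.
Qed.

Lemma gradient_iterate_cvg : gradient f (x t) @[t --> \oo] --> (0 : 'rV[R]_d).
Proof.
apply: cvg_enorm0.
have H : g t + A * (c * enorm (v t)) `^ alpha @[t --> \oo] --> 0.
  by rewrite -(addr0 0); apply: cvgD; [exact: gradient_aux_cvg|exact: xz_cvg].
apply: (squeeze_cvgr _ (cvg_cst 0) H); apply: nearW => t; rewrite enorm_ge0 /=.
by rewrite -lerBlDl; exact: le_trans (enormB _ _) (xz t).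
Qed.

(** The descent inequality is used from [z t] to [x t] and back, which bounds the difference on both
    sides; the gradients at both points and their distance tend to zero. *)
Lemma cost_iterate_diff : (f (x t) - f (z t)) @[t --> \oo] --> 0.
Proof.
pose w t := c * enorm (v t).
have w0 t : 0 <= w t by rewrite mulr_ge0 ?enorm_ge0.
have wcvg : w t @[t --> \oo] --> 0.
  by rewrite -(mulr0 c); apply: cvgM; [exact: cvg_cst|exact: vcvg].
have wE t : enorm (x t - z t) = w t.
  by rewrite xE addrAC subrr add0r enormN enormZ ger0_norm.
pose h t := (g t + enorm (gradient f (x t))) * w t + A * w t `^ (1 + alpha).
have hcvg : h t @[t --> \oo] --> 0.
  rewrite -(addr0 0); apply: cvgD.
    rewrite -(mulr0 (0 + 0)); apply: cvgM => //; apply: cvgD.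
      exact: gradient_aux_cvg.
    exact: cvg0_enorm gradient_iterate_cvg.
  rewrite -(mulr0 A); apply: cvgM; first exact: cvg_cst.
  by apply: cvg0_powR => //; rewrite addr_gt0.
have bd y y' : f y' - f y <= enorm (gradient f y) * enorm (y' - y) +
    A * enorm (y' - y) `^ (1 + alpha).
  have := holder_descent fdiff halpha hA fholder y (y' - y).
  rewrite addrC subrK; have := dot_le_enorm (gradient f y) (y' - y); lra.
apply/cvgr0Pnorm_le => e0 e00.
move/cvgr0Pnorm_le : hcvg => /(_ _ e00); apply: filterS => t.
move=> /(le_trans (ler_norm _)); apply: le_trans; rewrite ler_norml.
have gx0 : 0 <= enorm (gradient f (x t)) * w t by rewrite mulr_ge0 ?enorm_ge0.
have gz0 : 0 <= g t * w t by rewrite mulr_ge0 ?enorm_ge0.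
have := bd (z t) (x t); have := bd (x t) (z t); rewrite (enormBC (z t)) wE.
by rewrite /h mulrDl -/(g t) => h1 h2; apply/andP; split; lra.
Qed.

Lemma cost_iterate_cvg : cvgn (fun t => f (x t)).
Proof.
rewrite (_ : (fun t => f (x t)) = (fun t => f (x t) - f (z t) + f (z t))).
  apply/cvg_ex; exists (0 + limn (fun t => f (z t))).
  by apply: cvgD; [exact: cost_iterate_diff|exact: fz].
by apply/funext => t; rewrite subrK.
Qed.

(** The increment consists of a gradient step, an increment of the convergent [M] and values of [v],
    all of which vanish in the limit. *)
Lemma increment_cvg : (x t.+1 - x t) @[t --> \oo] --> (0 : 'rV[R]_d).
Proof.
have vcvg' : v t @[t --> \oo] --> (0 : 'rV[R]_d) by exact: cvg_enorm0.
have E t : x t.+1 - x t = - (r t / q) *: gradient f (x t) - q^-1 *: (M t.+1 - M t)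
    - c *: v t.+1 + c *: v t.
  rewrite scaleNr -step !xE; apply/rowP => i; rewrite !mxE; ring.
have -> : (0 : 'rV[R]_d) =
    - (0 / q) *: 0 - q^-1 *: (limn M - limn M) - c *: 0 + c *: 0.
  by rewrite subrr !scaler0 !subr0 addr0.
under eq_cvg do rewrite E.
have MS' : M t.+1 @[t --> \oo] --> limn M by rewrite cvg_shiftS.
have vS : v t.+1 @[t --> \oo] --> (0 : 'rV[R]_d) by rewrite cvg_shiftS.
apply: cvgD; last by apply: cvgZ; [exact: cvg_cst|exact: vcvg'].
apply: cvgB; last by apply: cvgZ; [exact: cvg_cst|exact: vS].
apply: cvgB; last by apply: cvgZ; [exact: cvg_cst|exact: cvgB].
apply: cvgZ; last exact: gradient_iterate_cvg.
by apply: cvgN; apply: cvgM; [exact: rcvg|exact: cvg_cst].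
Qed.

(** Convergence of [f (x t)] and coercivity confine the iterates to a ball and to a strip with
    finitely many critical points; [cvg_finite_zeros] applies with the norm of the gradient as
    [h]. *)
Lemma iterate_cvg : continuous (gradient f) ->
  (forall a b : R, a < b -> finite_set [set y | a <= f y <= b /\ gradient f y = 0]) ->
  f y @[y --> @enorm_infty R d] --> +oo%R ->
  cvgn x.
Proof.
move=> cgf fin coercive.
have cf : continuous f by move=> y; exact: differentiable_continuous.
have [B [_ HB]] := cvg_seq_bounded cost_iterate_cvg.
(* The maximum with [1] guarantees [- b < b], as the finiteness hypothesis requires. *)
pose b := Num.max 1 (B + 1).
have b0 : 0 < b by rewrite lt_max ltr01.
have fb t : `|f (x t)| <= b.
  apply: (HB b) => //; by rewrite lt_max ltrDl ltr01 orbT.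
have [rad Hrad] : exists rad : R, forall y, rad < enorm y -> b < f y.
  by apply: (coercive [set y | b < y]); exists b; split => //; exact: num_real.
have bound t : `|x t| <= rad.
  apply: le_trans (norm_le_enorm _) _; rewrite leNgt; apply/negP => /Hrad.
  by rewrite ltNge (le_trans (ler_norm _) (fb t)).
apply: (@cvg_finite_zeros R d x (fun y => enorm (gradient f y)) f rad (- b) b) => //.
- exact: increment_cvg.
- by move=> y; apply: continuous_comp; [exact: cgf|exact: enorm_continuous].
- exact: cvg0_enorm gradient_iterate_cvg.
- by move=> t; rewrite -ler_norml.
- have bb : - b < b by lra.
  have := fin _ _ bb; apply: sub_finite_set => y [h1 h2]; split => //.
  apply/eqP; rewrite -normr_eq0 eq_le normr_ge0 andbT.
  by rewrite -h2; exact: norm_le_enorm.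
Qed.

End trajectory.

(** * The momentum iteration *)

Section sum_process.
Context {R : realType} {d : nat} {dO dX : measure_display}
  {Omega : measurableType dO} {Xi : measurableType dX} (P : probability Omega R).
Variables (f : 'rV[R]_d -> R) (g : 'rV[R]_d -> Xi -> 'rV[R]_d)
  (xi : nat -> {RV P >-> Xi}) (gam : nat -> Omega -> R)
  (beta s alpha A m sigma2 C : R) (x0 : 'rV[R]_d) (G : nat -> set_system Omega).
Hypotheses
  (g_meas : measurable_fun [set: borelRn R d * Xi]
     (fun y : borelRn R d * Xi => g y.1 y.2 : borelRn R d))
  (hbeta : 0 <= beta < 1) (fC1 : continuously_differentiable f)
  (mf : forall y, m <= f y) (halpha : 0 < alpha <= 1) (hA : 0 < A)
  (fholder : forall y y' : 'rV[R]_d,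
     enorm (gradient f y - gradient f y') <= A * enorm (y - y') `^ alpha)
  (gmean : forall t y, has_mean P (fun w => g y (xi t w)) (gradient f y))
  (hsigma2 : 0 < sigma2) (hC : 0 < C)
  (gvar : forall t y,
     ('E_P[fun w => (enorm (g y (xi t w) - gradient f y) ^+ 2)%R] <=
      (sigma2 + C * enorm (gradient f y) ^+ 2)%:E)%E)
  (sG : forall t, <<s G t >> `<=` (@measurable _ Omega))
  (ndG : forall t, <<s G t >> `<=` <<s G t.+1 >>)
  (gam0 : forall t w, 0 <= gam t w) (mgam : forall t, adapted G t (gam t))
  (mxi : forall t, adapted G t.+1 (xi t))
  (xi_indep : forall t, independent_of (xi t) <<s G t >>).

Let fdiff y : differentiable f y. Proof. by case: fC1. Qed.
Let q := 1 - beta.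
Let q0 : 0 < q. Proof. by rewrite subr_gt0; case/andP: hbeta. Qed.
Let c := beta / q.
Let c0 : 0 <= c. Proof. by apply: divr_ge0; [case/andP: hbeta|exact: ltW]. Qed.
Let kappa := 1 - s * q.
Let p := 1 + alpha.
Let alpha0 : 0 < alpha. Proof. by case/andP: halpha. Qed.

Let state t w := sum_state g beta s x0 (gam ^~ w) (fun k => xi k w) t.
Let x t w : 'rV[R]_d := (state t w).1.
Let v t w : 'rV[R]_d := x t w - (state t w).2.
(* The recursion for [z] is a plain stochastic gradient step. *)
Let z t w : 'rV[R]_d := x t w + c *: v t w.
Let gr t w : 'rV[R]_d := g (x t w) (xi t w).

Let xE t w : x t w = z t w - c *: v t w.
Proof. by rewrite /z addrK. Qed.

Let vS t w : v t.+1 w = beta *: v t w - (kappa * gam t w) *: gr t w.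
Proof.
rewrite /v /x /state /= -/(state t w) -/(x t w) -/(gr t w).
by apply/rowP => i; rewrite !mxE /kappa /q; ring.
Qed.

Let zS t w : z t.+1 w = z t w - (gam t w / q) *: gr t w.
Proof.
rewrite {1}/z vS /x /state /= -/(state t w) -/(x t w) -/(gr t w).
apply/rowP => i; rewrite /z /v -/(x t w) !mxE /kappa /c; move: q0; rewrite /q => q0'.
by field; rewrite gt_eqF.
Qed.

Let measurable_oracle {d'} {T : measurableType d'} (h : T -> borelRn R d) (k : T -> Xi) :
  measurable_fun setT h -> measurable_fun setT k ->
  measurable_fun setT (fun y => g (h y) (k y) : borelRn R d).
Proof.
by move=> mh mk; exact: (measurableT_comp g_meas (measurable_fun_pair mh mk)).
Qed.

(** The state at time [t] uses only stepsizes and noise of index below [t]; [xi t] becomes available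
    in [G t.+1]. *)
Let measurable_state t :
  adapted G t (fun w => (state t w).1 : borelRn R d) /\
  adapted G t (fun w => (state t w).2 : borelRn R d).
Proof.
elim: t => [|t [mx my]]; first by split; exact: measurable_cst.
have mx' : adapted G t.+1 (fun w => x t w : borelRn R d) by exact: (adaptedS ndG).
have my' : adapted G t.+1 (fun w => (state t w).2 : borelRn R d) by exact: (adaptedS ndG).
have mgam' : adapted G t.+1 (gam t) by apply: (adaptedS ndG); exact: mgam.
have mgr : adapted G t.+1 (fun w => gr t w : borelRn R d).
  by apply: measurable_oracle => //; exact: mxi.
have ms : adapted G t.+1 (fun w => x t w - (s * gam t w) *: gr t w : borelRn R d).
  apply: measurable_borelB => //; apply: measurable_borelZ => //.
  exact: measurable_funM.
split=> //.
apply: measurable_borelD; first by apply: measurable_borelB => //; exact: measurable_borelZ.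
by apply: measurable_borelZ => //; exact: measurable_borelB.
Qed.

Let mx t : adapted G t (fun w => x t w : borelRn R d).
Proof. by case: (measurable_state t). Qed.

Let mv t : adapted G t (fun w => v t w : borelRn R d).
Proof. by apply: measurable_borelB; [exact: mx|case: (measurable_state t)]. Qed.

Let mz t : adapted G t (fun w => z t w : borelRn R d).
Proof.
apply: measurable_borelD; first exact: mx.
by apply: measurable_borelZ => //; exact: mv.
Qed.

Let cgrad : continuous (gradient f). Proof. by case: fC1. Qed.
Let cf : continuous f.
Proof. by move=> y; exact: differentiable_continuous. Qed.

Let measurable_cost {d'} {T : measurableType d'} (h : T -> borelRn R d) :
  measurable_fun setT h -> measurable_fun setT (fun y => f (h y)).
Proof.
move=> mh; apply: (@measurableT_comp _ _ _ _ _ _ (f : borelRn R d -> R)) => //.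
exact: measurable_borel_continuous.
Qed.

Let measurable_enorm {d'} {T : measurableType d'} (h : T -> borelRn R d) :
  measurable_fun setT h -> measurable_fun setT (fun y => enorm (h y : 'rV[R]_d)).
Proof.
move=> mh; apply: (@measurableT_comp _ _ _ _ _ _ (@enorm R d : borelRn R d -> R)) => //.
apply: measurable_borel_continuous; exact: enorm_continuous.
Qed.

Let measurable_gradient {d'} {T : measurableType d'} (h : T -> borelRn R d) :
  measurable_fun setT h -> measurable_fun setT (fun y => gradient f (h y) : borelRn R d).
Proof.
move=> mh.
apply: (@measurableT_comp _ _ _ _ _ _ (gradient f : borelRn R d -> borelRn R d)) => //.
exact: measurable_borel_continuous_vec.
Qed.

Let measurable_powR' {d'} {T : measurableType d'} (h : T -> R) (r : R) :
  measurable_fun setT h -> measurable_fun setT (fun y => h y `^ r).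
Proof.
by move=> mh; apply: (@measurableT_comp _ _ _ _ _ _ (fun y : R => y `^ r)).
Qed.

Let measurable_lyapunov {d'} {T : measurableType d'} (h k : T -> borelRn R d) :
  measurable_fun setT h -> measurable_fun setT k ->
  measurable_fun setT (fun y => lyapunov f alpha m beta (h y) (k y)).
Proof.
move=> mh mk; apply: measurable_funD.
  by apply: measurable_funD => //; apply: measurable_funB => //; exact: measurable_cost.
by apply: measurable_funM => //; apply: measurable_powR'; exact: measurable_enorm.
Qed.

Let measurable_dissipation {d'} {T : measurableType d'} (h k : T -> borelRn R d) (r : T -> R) :
  measurable_fun setT h -> measurable_fun setT k -> measurable_fun setT r ->
  measurable_fun setT (fun y => dissipation f alpha beta (h y) (k y) (r y)).
Proof.
move=> mh mk mr; apply: measurable_funD.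
  apply: measurable_funM; first exact: measurable_funM.
  by apply: measurable_funX; apply: measurable_enorm; exact: measurable_gradient.
by apply: measurable_powR'; exact: measurable_enorm.
Qed.

Let V t w := lyapunov f alpha m beta (z t w) (v t w).
Let D t w := dissipation f alpha beta (z t w) (v t w) (gam t w).

Let D_ge0 t w : 0 <= D t w.
Proof.
apply: addr_ge0; last exact: powR_ge0.
by rewrite mulr_ge0 ?sqr_ge0// divr_ge0// ltW.
Qed.

Let V_ge1 t w : 1 <= V t w. Proof. exact: lyapunov_ge1. Qed.

Let lyapunov_cvg : \forall w \ae P,
  cvgn (series (fun t => gam t w `^ p)) ->
  cvgn (fun t => V t w) /\ cvgn (series (fun t => D t w)).
Proof.
have [B B0 drift] := @lyapunov_drift _ _ f alpha A m beta kappa sigma2 C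
  fdiff halpha hA fholder mf hbeta hsigma2 hC.
have mV t : adapted G t (V t) by apply: measurable_lyapunov; [exact: mz|exact: mv].
have := @robbins_siegmund R _ _ P G sG ndG V (fun t w => B * gam t w `^ p) D.
have V0 t w : 0 <= V t w by exact: le_trans ler01 (V_ge1 t w).
have a0 t w : 0 <= B * gam t w `^ p by rewrite mulr_ge0// powR_ge0.
have ma t : adapted G t (fun w => B * gam t w `^ p).
  by apply: measurable_funM => //; apply: measurable_powR'; exact: mgam.
have mD t : adapted G t (D t).
  by apply: measurable_dissipation; [exact: mz|exact: mv|exact: mgam].
have EV0 : (\int[P]_w (V 0%N w)%:E < +oo)%E.
  rewrite (_ : (fun w => (V 0%N w)%:E) = cst (lyapunov f alpha m beta x0 0)%:E).
    by rewrite integral_cst//= probability_setT mule1 ltry.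
  apply/funext => w; rewrite /V /z /v /x /state /= subrr scaler0 addr0//.
have dr t (phi : Omega -> R) : adapted G t phi -> (forall w, 0 <= phi w) ->
    (\int[P]_w (phi w * (V t.+1 w + D t w))%:E <=
     \int[P]_w (phi w * ((1 + B * gam t w `^ p) * V t w))%:E)%E.
  move=> mphi phi0.
  (* One step as a function of the past [y.1] and of the fresh noise [y.2]: its value at
     [(w, xi t w)] is [V t.+1 w + D t w]. *)
  pose h (y : g_sigma_algebraType (G t) * Xi) :=
    lyapunov f alpha m beta (z t y.1 - (gam t y.1 / q) *: g (x t y.1) y.2)
      (beta *: v t y.1 - (kappa * gam t y.1) *: g (x t y.1) y.2) + D t y.1.
  have mgam1 : measurable_fun [set: g_sigma_algebraType (G t) * Xi] (fun y => gam t y.1).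
    exact: measurableT_comp (@mgam t) measurable_fst.
  have mz1 : measurable_fun [set: g_sigma_algebraType (G t) * Xi]
      (fun y => z t y.1 : borelRn R d).
    exact: measurableT_comp (@mz t) measurable_fst.
  have mv1 : measurable_fun [set: g_sigma_algebraType (G t) * Xi]
      (fun y => v t y.1 : borelRn R d).
    exact: measurableT_comp (@mv t) measurable_fst.
  have mg1 : measurable_fun [set: g_sigma_algebraType (G t) * Xi]
      (fun y => g (x t y.1) y.2 : borelRn R d).
    apply: measurable_oracle; last exact: measurable_snd.
    exact: measurableT_comp (@mx t) measurable_fst.
  have mh : measurable_fun setT h.
    apply: measurable_funD; last by apply: measurable_dissipation.
    apply: measurable_lyapunov.
      apply: measurable_borelB => //; apply: measurable_borelZ => //.
      exact: measurable_funM.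
    apply: measurable_borelB; apply: measurable_borelZ => //.
    exact: measurable_funM.
  have h0 y : 0 <= h y.
    apply: addr_ge0; last exact: D_ge0.
    by apply: le_trans ler01 _; exact: lyapunov_ge1.
  have -> : (\int[P]_w (phi w * (V t.+1 w + D t w))%:E =
      \int[P]_w (phi w * h (w, xi t w))%:E)%E.
    by apply: eq_integral => w _; rewrite /V zS vS.
  apply: (@integral_freezing_le _ _ _ _ _ P (G t) (@sG t) (xi t) (@xi_indep t) h) => //.
    by apply: measurable_funM; [apply: measurable_funD => //; exact: ma|exact: mV].
  move=> w.
  have [k0 [u [k [k0' Hle Hfin]]]] := drift (z t w) (v t w) (gradient f (x t w)) (gam t w)
    (gam0 t w) (congr1 (gradient f) (xE t w)).
  have := @integral_mean_bound R d _ _ P (fun w' => h (w, xi t w'))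
    (fun w' => g (x t w) (xi t w')) (gradient f (x t w)) u k0 k
    (sigma2 + C * enorm (gradient f (x t w)) ^+ 2).
  move=> /(_ _ _ k0' (gmean t _) (gvar t _)) H.
  apply: le_trans (H _ _ _) _.
  - by apply: (@measurable_fun_freeze _ _ _ _ _ _ _ _ h (xi t) w mh).
  - by move=> w'.
  - by move=> w'; exact: Hle.
  - by rewrite lee_fin.
move=> /(_ V0 a0 D_ge0 mV ma mD EV0 dr); apply: filterS => w H cg; apply: H.
rewrite (_ : series _ = fun t => B * series (fun t => gam t w `^ p) t).
  by apply/cvg_ex; eexists; apply: cvgM; [exact: cvg_cst|exact: cg].
by apply/funext => t; rewrite /series /= mulr_sumr.
Qed.

Let noise t w : 'rV[R]_d := gr t w - gradient f (x t w).
Let M (i : 'I_d) t w : R := \sum_(k < t) gam k w * noise k w 0 i.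

(** The square grows in conditional mean by at most the variance bound [a t]. Adding [1] gives
    [U t >= 1], so that [U t + a t <= (1 + a t) * U t] and the Robbins-Siegmund theorem applies. *)
Let noise_shift_cvg i (k0 : R) : \forall w \ae P,
  cvgn (series (fun t => gam t w ^+ 2 * (sigma2 + C * enorm (gradient f (x t w)) ^+ 2))) ->
  cvgn (fun t => (M i t w + k0) ^+ 2).
Proof.
pose a t w := gam t w ^+ 2 * (sigma2 + C * enorm (gradient f (x t w)) ^+ 2).
pose U t w := 1 + (M i t w + k0) ^+ 2.
have a0 t w : 0 <= a t w.
  by rewrite mulr_ge0 ?sqr_ge0// addr_ge0 ?(ltW hsigma2)// mulr_ge0 ?sqr_ge0// ltW.
have U0 t w : 0 <= U t w by rewrite addr_ge0// sqr_ge0.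
have mgx t : adapted G t (fun w => gradient f (x t w) : borelRn R d).
  by apply: measurable_gradient; exact: mx.
have mgr t : adapted G t.+1 (fun w => gr t w : borelRn R d).
  by apply: measurable_oracle; [apply: (adaptedS ndG); exact: mx|exact: mxi].
have mM t : adapted G t (M i t).
  apply: measurable_sum => k; apply: (adapted_le ndG (ltn_ord k)).
  apply: measurable_funM; first by apply: (adaptedS ndG); exact: mgam.
  apply: measurable_borel_coord; apply: measurable_borelB; first exact: mgr.
  by apply: (adaptedS ndG); exact: mgx.
have mU t : adapted G t (U t).
  apply: measurable_funD => //; apply: measurable_funX; apply: measurable_funD => //.
  exact: mM.
have ma t : adapted G t (a t).
  apply: measurable_funM; first by apply: measurable_funX; exact: mgam.
  apply: measurable_funD => //; apply: measurable_funM => //.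
  by apply: measurable_funX; apply: measurable_enorm; exact: mgx.
have EU0 : (\int[P]_w (U 0%N w)%:E < +oo)%E.
  rewrite (_ : (fun w => (U 0%N w)%:E) = cst (1 + k0 ^+ 2)%:E).
    by rewrite integral_cst//= probability_setT mule1 ltry.
  by apply/funext => w; rewrite /U /M big_ord0 add0r.
have m0 t : adapted G t (fun _ : Omega => 0 : R) by exact: measurable_cst.
have := @robbins_siegmund R _ _ P G sG ndG U a (fun _ _ => 0 : R) U0 a0
  (fun _ _ => lexx 0) mU ma m0 EU0.
have dr t (phi : Omega -> R) : adapted G t phi -> (forall w, 0 <= phi w) ->
    (\int[P]_w (phi w * (U t.+1 w + 0))%:E <=
     \int[P]_w (phi w * ((1 + a t w) * U t w))%:E)%E.
  move=> mphi phi0.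
  pose h (y : g_sigma_algebraType (G t) * Xi) := 1 + (M i t y.1 + k0 +
    gam t y.1 * (g (x t y.1) y.2 - gradient f (x t y.1)) 0 i) ^+ 2.
  have mg1 : measurable_fun [set: g_sigma_algebraType (G t) * Xi]
      (fun y => g (x t y.1) y.2 : borelRn R d).
    apply: measurable_oracle; last exact: measurable_snd.
    exact: measurableT_comp (@mx t) measurable_fst.
  have mh : measurable_fun setT h.
    apply: measurable_funD => //; apply: measurable_funX; apply: measurable_funD.
      apply: measurable_funD => //; exact: measurableT_comp (@mM t) measurable_fst.
    apply: measurable_funM; first exact: measurableT_comp (@mgam t) measurable_fst.
    apply: measurable_borel_coord; apply: measurable_borelB => //.
    exact: measurableT_comp (@mgx t) measurable_fst.
  have h0 y : 0 <= h y by rewrite addr_ge0// sqr_ge0.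
  have -> : (\int[P]_w (phi w * (U t.+1 w + 0))%:E =
      \int[P]_w (phi w * h (w, xi t w))%:E)%E.
    apply: eq_integral => w _; rewrite addr0 /U /M big_ord_recr /= /h /M.
    by rewrite (addrAC _ _ k0).
  apply: (@integral_freezing_le _ _ _ _ _ P (G t) (@sG t) (xi t) (@xi_indep t) h) => //.
    by apply: measurable_funM; [apply: measurable_funD => //; exact: ma|exact: mU].
  move=> w.
  (* The square is expanded in the new noise: the linear coefficient sits on coordinate [i], and the
     squared coordinate is bounded by the squared norm. *)
  have := @integral_mean_bound R d _ _ P (fun w' => h (w, xi t w'))
    (fun w' => g (x t w) (xi t w')) (gradient f (x t w))
    ((2 * gam t w * (M i t w + k0)) *: delta_mx 0 i) (U t w) (gam t w ^+ 2)
    (sigma2 + C * enorm (gradient f (x t w)) ^+ 2).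
  move=> /(_ _ _ (sqr_ge0 _) (gmean t _) (gvar t _)) H.
  apply: le_trans (H _ _ _) _.
  - by apply: (@measurable_fun_freeze _ _ _ _ _ _ _ _ h (xi t) w mh).
  - by move=> w'.
  - move=> w'; set y := g _ _ - _.
    have yi : y 0 i ^+ 2 <= enorm y ^+ 2.
      rewrite -real_normK ?num_real// ler_pXn2r ?nnegrE ?enorm_ge0//.
      exact: le_trans (coord_le_norm _ _) (norm_le_enorm _).
    have dy : dot (delta_mx 0 i) y = y 0 i.
      rewrite /dot (bigD1 i)//= mxE !eqxx mul1r big1 ?addr0// => j ji.
      by rewrite mxE (negbTE ji) mul0r.
    rewrite dotZl dy /h /U /=.
    rewrite -/y; have -> : 1 + (M i t w + k0 + gam t w * y 0 i) ^+ 2 =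
      1 + (M i t w + k0) ^+ 2 + 2 * gam t w * (M i t w + k0) * y 0 i +
      gam t w ^+ 2 * y 0 i ^+ 2 by ring.
    by rewrite lerD2l ler_wpM2l// sqr_ge0.
  - rewrite lee_fin -/(a t w) mulrDl mul1r lerD2l ler_peMr//.
    by rewrite /U lerDl sqr_ge0.
move=> /(_ dr); apply: filterS => w H ca.
have [cU _] := H ca.
rewrite (_ : (fun t => _) = fun t => U t w - 1).
  by apply/cvg_ex; eexists; apply: cvgB; [exact: cU|exact: cvg_cst].
by apply/funext => t; rewrite /U addrAC subrr add0r.
Qed.

(** Two squares determine the limit including its sign: [2 M = (M + 1)^2 - M^2 - 1]. *)
Let noise_cvg : \forall w \ae P,
  cvgn (series (fun t => gam t w ^+ 2 * (sigma2 + C * enorm (gradient f (x t w)) ^+ 2))) ->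
  forall i, cvgn (fun t => M i t w).
Proof.
have : \forall w \ae P, forall i, cvgn (series (fun t => gam t w ^+ 2 *
      (sigma2 + C * enorm (gradient f (x t w)) ^+ 2))) -> cvgn (fun t => M i t w).
  apply: filter_forall => i.
  have := noise_shift_cvg i 0; have := noise_shift_cvg i 1.
  apply: filterS2 => w H1 H0 ca.
  rewrite (_ : (fun t => _) =
      fun t => ((M i t w + 1) ^+ 2 - (M i t w + 0) ^+ 2 - 1) * 2^-1).
    apply/cvg_ex; eexists; apply: cvgM; last exact: cvg_cst.
    by apply: cvgB; [apply: cvgB; [exact: H1|exact: H0]|exact: cvg_cst].
  by apply/funext => t; field.
by apply: filterS => w H ca i; exact: H.
Qed.

(** The probabilistic input is two almost sure statements; what remains is to check the pathwise
    hypotheses for a fixed [w]. *)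
Lemma sum_iterate_ae_cvg : \forall w \ae P,
  ~ cvgn (series (gam ^~ w)) -> cvgn (series (fun t => gam t w `^ (1 + alpha))) ->
  [/\ cvg (f (x t w) @[t --> \oo]),
      gradient f (x t w) @[t --> \oo] --> (0 : 'rV[R]_d) &
      (forall a b : R, a < b ->
         finite_set [set y | a <= f y <= b /\ gradient f y = 0]) ->
      f y @[y --> @enorm_infty R d] --> +oo%R ->
      cvg (x t w @[t --> \oo])].
Proof.
move: lyapunov_cvg noise_cvg; apply: filterS2 => w HV HN gdiv gsum.
have p0 : 0 < p by rewrite addr_gt0.
have [cV cD] := HV gsum.
have gcvg : gam t w @[t --> \oo] --> 0.
  by apply: (powR_cvg0_inv p0); [move=> t|exact: cvg_series_cvg_0 gsum].
have q1 : q <= 1 by rewrite /q; case/andP: hbeta; lra.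
have G0 t : 0 <= gam t w * enorm (gradient f (z t w)) ^+ 2 by rewrite mulr_ge0 ?sqr_ge0.
have diss : cvgn (series (fun t => gam t w * enorm (gradient f (z t w)) ^+ 2)).
  apply: near_le_series_cvg cD => //; apply: nearW => t.
  apply: (@le_trans _ _ (gam t w / q * enorm (gradient f (z t w)) ^+ 2)).
    by rewrite mulrAC ler_pdivlMr// ler_piMr.
  by rewrite lerDl powR_ge0.
have vp : enorm (v t w) `^ p @[t --> \oo] --> 0.
  apply: cvg_series_cvg_0; apply: near_le_series_cvg cD => // [t|]; first exact: powR_ge0.
  by apply: nearW => t; rewrite lerDr mulr_ge0 ?sqr_ge0// divr_ge0// ltW.
have vcvg : enorm (v t w) @[t --> \oo] --> 0.
  by apply: (powR_cvg0_inv p0); [move=> t; exact: enorm_ge0|exact: vp].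
have fz : cvgn (fun t => f (z t w)).
  rewrite (_ : (fun t => _) = fun t => V t w - 2 / q * enorm (v t w) `^ p + (m - 1)).
    apply/cvg_ex; eexists; apply: cvgD; last exact: cvg_cst.
    by apply: cvgB; [exact: cV|apply: cvgM; [exact: cvg_cst|exact: vp]].
  by apply/funext => t; rewrite /V /lyapunov -/q -/p; ring.
have [Mb Mb0 gM] := @gradient_sqr_lyapunov _ _ f alpha A m beta fdiff halpha hA fholder mf hbeta.
(* The convergent [V] is bounded, which bounds the gradients at the iterates; eventually [gam <= 1],
   so [gam^2 <= gam^p] and the variance series converges. *)
have [Vb HVb] : exists Vb, forall t, V t w <= Vb.
  have [Vb [_ HVb]] := cvg_seq_bounded cV.
  exists (Vb + 1) => t; apply: le_trans (ler_norm _) _.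
  by apply: HVb => //; rewrite ltrDl.
have sq : cvgn (series (fun t => gam t w ^+ 2 * (sigma2 + C * enorm (gradient f (x t w)) ^+ 2))).
  have K0 t : 0 <= sigma2 + C * enorm (gradient f (x t w)) ^+ 2.
    by rewrite addr_ge0 ?(ltW hsigma2)// mulr_ge0 ?sqr_ge0// ltW.
  pose K := sigma2 + C * (Mb * Vb).
  have xK t : sigma2 + C * enorm (gradient f (x t w)) ^+ 2 <= K.
    rewrite lerD2l ler_wpM2l ?(ltW hC)// xE; have [_] := gM (z t w) (v t w).
    by move=> H; exact: le_trans H (ler_wpM2l Mb0 (HVb t)).
  have K0' : 0 <= K := le_trans (K0 0%N) (xK 0%N).
  apply: (@near_le_series_cvg _ _ (fun t => K * gam t w `^ p)).
  - by move=> t; exact: mulr_ge0 (sqr_ge0 _) (K0 t).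
  - by move=> t; exact: mulr_ge0 K0' (powR_ge0 _ _).
  - have := gcvg; move/cvgr0Pnorm_le => /(_ 1 ltr01); apply: filterS => t.
    rewrite ger0_norm// => g1; rewrite mulrC; apply: ler_pM; [exact: K0|exact: sqr_ge0|exact: xK|].
    have [->|gn0] := eqVneq (gam t w) 0; first by rewrite expr0n powR_ge0.
    rewrite -powR_mulrn//; apply: ger_powR.
      by rewrite g1 andbT lt_neqAle eq_sym gn0 gam0.
    by rewrite /p; case/andP: halpha; lra.
  rewrite (_ : series _ = fun t => K * series (fun t => gam t w `^ p) t).
    by apply/cvg_ex; eexists; apply: cvgM; [exact: cvg_cst|exact: gsum].
  by apply/funext => t; rewrite /series /= mulr_sumr.
have cN := HN sq.
have xEw t : x t w = z t w - c *: v t w by exact: xE.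
have zSw t : z t.+1 w = z t w - (gam t w / q) *: (gradient f (x t w) + noise t w).
  by rewrite zS /noise (addrC (gradient f (x t w))) subrK.
have gam0w t : 0 <= gam t w by exact: gam0.
split.
- exact: (@cost_iterate_cvg R d f alpha A c q fdiff halpha hA fholder c0 q0 _ _ _ _ _
    xEw zSw gam0w gdiv gcvg fz vcvg diss cN).
- exact: (@gradient_iterate_cvg R d f alpha A c q halpha hA fholder c0 q0 _ _ _ _ _
    xEw zSw gam0w gdiv gcvg vcvg diss cN).
- move=> fin coercive.
  exact: (@iterate_cvg R d f alpha A c q fdiff halpha hA fholder c0 q0 _ _ _ _ _
    xEw zSw gam0w gdiv gcvg fz vcvg diss cN cgrad fin coercive).
Qed.

End sum_process.

(** * The filtration generated by the stepsizes and the noise *)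

Section history.
Context {dO dX : measure_display} {Omega : measurableType dO}
  {Xi : measurableType dX} {R : realType} {P : probability Omega R}.
Variables (gamma : nat -> {RV P >-> R}) (xi : nat -> {RV P >-> Xi}).

(** The generators of [history] are named separately because [adapted] takes a generating family. *)
Definition history_generator (t : nat) : set_system Omega :=
  (\bigcup_(k in [set k | (k <= t)%N]) g_sigma_algebra_preimage (gamma k)) `|`
  (\bigcup_(k in [set k | (k < t)%N]) g_sigma_algebra_preimage (xi k)).

Lemma history_measurable t : <<s history_generator t >> `<=` (@measurable _ Omega).
Proof.
apply: smallest_sub; first exact: sigma_algebra_measurable.
by move=> B [[k _ [E mE <-]]|[k _ [E mE <-]]]; exact: measurable_funP.
Qed.

Lemma historyS t : <<s history_generator t >> `<=` <<s history_generator t.+1 >>.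
Proof.
apply: smallest_sub; first exact: smallest_sigma_algebra.
apply: subset_trans (@sub_sigma_algebra _ _ _).
move=> B [[k kt hB]|[k kt hB]]; [left|right]; exists k => //=.
  by move: kt => /= /leqW.
by move: kt => /= /ltnW.
Qed.

Lemma adapted_stepsize t : adapted history_generator t (gamma t).
Proof.
move=> _ B mB; apply: sub_sigma_algebra; left; exists t => //=.
by exists B.
Qed.

Lemma adapted_noise t : adapted history_generator t.+1 (xi t).
Proof.
move=> _ B mB; apply: sub_sigma_algebra; right; exists t => //=.
by exists B.
Qed.

End history.

Lemma nneseries_pinfty_ncvgn {R : realType} (u : nat -> R) :
  (\sum_(0 <= t <oo) (u t)%:E = +oo)%E -> ~ cvgn (series u).
Proof.
move=> su cu.
have : (series u n)%:E @[n --> \oo] --> (limn (series u))%:E.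
  by apply/fine_cvgP; split; [exact: nearW|exact: cu].
move/cvg_lim => /(_ (@ereal_hausdorff R)) E.
move: su; rewrite (_ : (\sum_(0 <= t <oo) (u t)%:E)%E = (limn (series u))%:E)//.
by rewrite -E; congr (lim (_ @ \oo)); apply/funext => n; rewrite /series /= sumEFin.
Qed.

Theorem theorem3 (R : realType) (d : nat)
  (dO dX : measure_display) (Omega : measurableType dO)
  (Xi : measurableType dX) (P : probability Omega R)
  (f : 'rV[R]_d -> R) (g : 'rV[R]_d -> Xi -> 'rV[R]_d)
  (xi : nat -> {RV P >-> Xi}) (gamma : nat -> {RV P >-> R})
  (beta s alpha A : R) (x0 : 'rV[R]_d)
  (x : nat -> Omega -> 'rV[R]_d)
  (hx : forall (t : nat) (w : Omega), x t w =
     sum_iterate g beta s x0 (fun k => gamma k w) (fun k => xi k w) t)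
  (g_meas : measurable_fun [set: borelRn R d * Xi]
     (fun p : borelRn R d * Xi => g p.1 p.2 : borelRn R d))
  (hbeta : 0 <= beta < 1) (hs : 0 <= s)
  (A1_C1 : continuously_differentiable f)
  (A1_inf : (-oo < ereal_inf (range (fun z => (f z)%:E)))%E)
  (halpha : 0 < alpha <= 1) (hA : 0 < A)
  (A2 : forall z z' : 'rV[R]_d,
     enorm (gradient f z - gradient f z') <= A * enorm (z - z') `^ alpha)
  (A3 : forall (t : nat) (z : 'rV[R]_d),
     has_mean P (fun w => g z (xi t w)) (gradient f z))
  (A4 : exists sigma2 C : R, [/\ 0 < sigma2, 0 < C &
     forall (t : nat) (z : 'rV[R]_d),
       ('E_P[fun w => (enorm (g z (xi t w) - gradient f z) ^+ 2)%R] <=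
        (sigma2 + C * enorm (gradient f z) ^+ 2)%:E)%E])
  (A5 : mutually_independent xi)
  (hgamma : \forall w \ae P,
     [/\ forall t : nat, 0 <= gamma t w,
         (\sum_(0 <= t <oo) (gamma t w)%:E = +oo)%E &
         (\sum_(0 <= t <oo) (gamma t w `^ (1 + alpha))%:E < +oo)%E])
  (xi_indep : forall t : nat, independent_of (xi t) (history gamma xi t)) :
  [/\ \forall w \ae P, cvg (f (x t w) @[t --> \oo]),
      \forall w \ae P, gradient f (x t w) @[t --> \oo] --> (0 : 'rV[R]_d) &
      (forall a b : R, a < b ->
         finite_set [set z | a <= f z <= b /\ gradient f z = 0]) ->
      f z @[z --> @enorm_infty R d] --> +oo%R ->
      \forall w \ae P, cvg (x t w @[t --> \oo])].

Proof.
(* Besides finite values, only [+oo] has to be excluded for the infimum, by comparison with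
   [f 0]. *)
have [m mf] : exists m, forall y, m <= f y.
  have [fin|] := boolP (ereal_inf (range (fun y => (f y)%:E)) \is a fin_num).
    exists (fine (ereal_inf (range (fun y => (f y)%:E)))) => y.
    by rewrite -lee_fin fineK//; apply: ereal_inf_lbound; exists y.
  rewrite fin_numE (gt_eqF A1_inf) /= negbK => /eqP inf_oo.
  have : (ereal_inf (range (fun y => (f y)%:E)) <= (f 0)%:E)%E.
    by apply: ereal_inf_lbound; exists 0.
  by rewrite inf_oo.
have [sigma2 [C [hsigma2 hC gvar]]] := A4.
(* The stepsizes are nonnegative only almost surely. The absolute value is so everywhere, remains
   adapted, and leaves almost every trajectory unchanged. *)
pose gam t (w : Omega) := `|gamma t w|.
have gam0 t w : 0 <= gam t w by exact: normr_ge0.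
have mgam t : adapted (history_generator gamma xi) t (gam t).
  apply: (@measurableT_comp _ _ _ _ _ _ (@Num.norm R R)) => //.
  exact: adapted_stepsize.
have main := @sum_iterate_ae_cvg R d dO dX Omega Xi P f g xi gam beta s alpha A m sigma2 C x0
  (history_generator gamma xi) g_meas hbeta A1_C1 mf halpha hA A2 A3 hsigma2 hC gvar
  (@history_measurable _ _ _ _ _ _ gamma xi) (@historyS _ _ _ _ _ _ gamma xi)
  gam0 mgam (@adapted_noise _ _ _ _ _ _ gamma xi) xi_indep.
have {}main : \forall w \ae P,
    [/\ cvg (f (x t w) @[t --> \oo]),
      gradient f (x t w) @[t --> \oo] --> (0 : 'rV[R]_d) &
      (forall a b : R, a < b ->
         finite_set [set y | a <= f y <= b /\ gradient f y = 0]) ->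
      f y @[y --> @enorm_infty R d] --> +oo%R ->
      cvg (x t w @[t --> \oo])].
  move: hgamma main; apply: filterS2 => w [g0 gdiv gsum].
  have gE : gam ^~ w = (fun t => gamma t w).
    by apply/funext => t; rewrite /gam ger0_norm.
  have ndiv : ~ cvgn (series (fun t => gamma t w)) by exact: nneseries_pinfty_ncvgn.
  have cs : cvgn (series (fun t => gam t w `^ (1 + alpha))).
    rewrite (_ : (fun t => _) = (fun t => gamma t w `^ (1 + alpha))).
      by apply: nnseries_is_cvg => // t; exact: powR_ge0.
    by apply/funext => t; rewrite /gam ger0_norm.
  have -> : x = fun t w => (sum_state g beta s x0 (fun k => gamma k w) (fun k => xi k w) t).1.
    by apply/funext => t; apply/funext => w'; exact: hx.
  by rewrite gE => H; exact: (H ndiv cs).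
split.
- by apply: filterS main => w [].
- by apply: filterS main => w [].
- by move=> fin coercive; apply: filterS main => w [_ _]; exact.
Qed.
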